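(* For every integer $n\geq 8$, the crossing number of the $n$-dimensional augmented cube $AQ_n$ satisfies $$cr(AQ_n)<\frac{26}{32}\,4^{n}-\Big(2n^2+\frac{7}{2}n-6\Big)2^{n-2}.$$
   Context: The crossing number $cr(G)$ of a graph $G$ is the minimum number of pairwise edge crossings over all good drawings of $G$ in the plane. A drawing is good if no edge crosses itself, no two adjacent edges cross, no two edges cross more than once, and no three edges cross in a common point (the crossing number is always attained by a good drawing). The $n$-dimensional augmented cube $AQ_n$ is the graph with vertex set $\{0,1\}^n$ (vertices written $a_na_{n-1}\cdots a_1$) defined recursively: $AQ_1$ is the complete graph $K_2$ on $\{0,1\}$. For $n\ge 2$, $AQ_n$ consists of two copies of $AQ_{n-1}$, one on the vertices $0a_{n-1}\cdots a_1$ and the other on the vertices $1b_{n-1}\cdots b_1$, together with edges joining $0a_{n-1}\cdots a_1$ to $1b_{n-1}\cdots b_1$ if and only if either $a_i=b_i$ for all $i\in[1,n-1]$, or $a_i=1-b_i$ for all $i\in[1,n-1]$. *)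

(* Defs.v *)
From HB Require Import structures.
From mathcomp Require Import all_boot all_order all_algebra.
From mathcomp Require Import all_classical all_reals all_analysis.
Set Implicit Arguments.
Unset Strict Implicit.
Unset Printing Implicit Defensive.
Import Order.TTheory GRing.Theory Num.Theory.
Import numFieldNormedType.Exports.
Local Open Scope classical_set_scope.
Local Open Scope ring_scope.

Record sgraph (T : finType) := SGraph {
  adj : rel T;
  adj_sym : symmetric adj;
  adj_irr : irreflexive adj }.

(* Edges are unordered pairs of adjacent vertices. *)
Definition edges (T : finType) (G : sgraph T) : {set {set T}} :=
  [set [set xy.1; xy.2]%SET | xy : T * T & adj G xy.1 xy.2].

(* Candidate drawings in the plane R * R; the values of [curve] matter only on
   edges and on the unit interval. *)
Record drawing (R : realType) (T : finType) := Drawing {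
  pos : T -> R * R;
  curve : {set T} -> R -> R * R }.

Section Drawings.
Variables (R : realType) (T : finType) (G : sgraph T) (D : drawing R T).

Definition is_drawing : Prop :=
  [/\ injective (pos D),
      forall e, e \in edges G -> {within `[0, 1], continuous (curve D e)},
      forall e, e \in edges G ->
        [set curve D e 0; curve D e 1] = [set pos D v | v in [set` e]]
    & forall e v t, e \in edges G -> 0 < t < 1 -> curve D e t <> pos D v].

(* Points interior to both edge curves; a tangential contact also counts as a
   crossing, which does not affect the minimum defining the crossing number. *)
Definition crossing_points (e f : {set T}) : set (R * R) :=
  (curve D e @` `]0, 1[) `&` (curve D f @` `]0, 1[).

Definition is_good : Prop :=
  [/\ forall e, e \in edges G -> {in `[0, 1] &, injective (curve D e)},
      forall e f, e \in edges G -> f \in edges G -> e != f ->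
        ~~ [disjoint e & f] -> crossing_points e f = set0,
      forall e f p q, e \in edges G -> f \in edges G -> e != f ->
        crossing_points e f p -> crossing_points e f q -> p = q
    & forall e f g p, e \in edges G -> f \in edges G -> g \in edges G ->
        e != f -> e != g -> f != g ->
        ~ (crossing_points e f p /\ crossing_points e g p)].

Definition good_drawing : Prop := is_drawing /\ is_good.

(* Since two edges of a good drawing cross at most once, its crossings are
   counted by the unordered pairs of distinct edges that cross. *)
Definition crossings : nat :=
  #|[set [set ef.1; ef.2]%SET | ef : {set T} * {set T} &
      [&& ef.1 \in edges G, ef.2 \in edges G, ef.1 != ef.2
        & `[< crossing_points ef.1 ef.2 !=set0 >]]]%SET|.

End Drawings.

(* An infimum of natural numbers: a minimum as soon as a good drawing exists,
   and +oo (never a spurious finite value) otherwise. *)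
Definition crossing_number (R : realType) (T : finType) (G : sgraph T) : \bar R :=
  ereal_inf [set (crossings G D)%:R%:E | D in [set D : drawing R T | good_drawing G D]].

(* Words are read from the left: a_n is the head of the sequence. *)
Fixpoint aq_adj (x y : seq bool) : bool :=
  match x, y with
  | [:: a], [:: b] => a != b
  | a :: x', b :: y' =>
      if a == b then aq_adj x' y' else (x' == y') || (x' == map negb y')
  | _, _ => false
  end.

Lemma aq_adj_sym : symmetric aq_adj.
Proof.
have negs (s t : seq bool) : (s == map negb t) = (t == map negb s).
  by apply/eqP/eqP => ->; rewrite mapK //; exact: negbK.
elim=> [|a x IH] [|b y] //=; first by case: y.
  by case: x {IH}.
case: x IH => [|a' x] IH; case: y => [|b' y] /=; rewrite (eq_sym b a) //;
  case: ifP => _ //; last 1 first.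
  by congr (_ || _); [rewrite eq_sym|exact: (negs (a' :: x) (b' :: y))].
- by case: y.
- by case: x {IH}.
- exact: (IH (b' :: y)).
Qed.

Lemma aq_adj_irr : irreflexive aq_adj.
Proof. by elim=> [|a [|a' x] IH] //=; rewrite eqxx. Qed.

Definition AQ (n : nat) : sgraph (n.-tuple bool) :=
  @SGraph (n.-tuple bool) (fun x y => aq_adj x y)
    (fun x y => aq_adj_sym x y) (fun x => aq_adj_irr x).

(* Main.v *)
Require Import Defs.
From Stdlib Require Import ZArith.
From mathcomp Require Import all_boot all_order all_algebra.
From mathcomp Require Import ring lra zify ssrZ.
Set Implicit Arguments.
Unset Strict Implicit.
Unset Printing Implicit Defensive.
Import Order.TTheory GRing.Theory Num.Theory.

(** Vertices are placed on the sphere and edges are drawn as minor great-circle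
    arcs. Two such arcs cross at most once and never when they share an endpoint,
    and whether they cross is decided by the signs of four determinants; a generic
    perturbation rules out triple points.

    A vertex [x] of a weighted graph can be split into two nearby points on a
    great circle halving its edges. Every crossing then yields four, and the new
    crossings are local: at [x], one for each pair of (weighted) edges on the same
    side of the halving circle, and for each edge those among its own four strands.

    In the coordinates given by consecutive sums, the generators of the augmented
    cube are the letters [t_i] and the pairs [t_i + t_(i+1)]. Identify points that
    differ by the middle letters [t_4, ..., t_(n-k+3)]: the quotient of dimension
    [k] is a Cayley graph of degree [2k] whose edge weights are 1, except for two
    classes of weight 2, the letters next to the gap. Splitting its vertices gives
    the quotient of dimension [k+1] and adds at most [2^k k^2] crossings. Starting
    from a drawing of the quotient of dimension 7 found by simulated annealing,
    this leads to at most [13/16 4^n - (2n^2 + 4n + 6) 2^(n-2)] crossings. *)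

(** * Spherical geometry *)

Local Open Scope ring_scope.

Section Small.
Variable R : realFieldType.

(** The cost [2^k k^2] of a splitting is the outcome of an exact cancellation. With weights up to 2
    a vertex can be halved only up to a difference of 2, which costs 2 in the sum of the squares of
    the two sides; leaving out the diagonal saves the squared weights, [2k + 4] because exactly two
    weights are 2; the strands over single edges put [2k + 2] back. In ordered pairs, [2k^2] remains
    at each vertex. Hence the sums of the weights and of their squares are the invariants to carry
    along. Iterating [C -> 4 C + 2^k k^2] from any start gives [c 4^k - (2k^2 + 4k + 6) 2^(k-2)]:
    the polynomial is forced and only [c] depends on the start. In dimension 7, [c = 13/16] asks for
    at most 9088 weighted crossings. Closing the gap takes one further doubling, whence [n >= 8].
    Against the stated bound a margin of [(n/2 + 12) 2^(n-2)] is left, which makes the inequality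
    strict. *)

Definition small (Q : R -> Prop) := exists2 e0 : R, 0 < e0 & forall e, 0 < e < e0 -> Q e.

Lemma small_ex Q : small Q -> exists2 e, 0 < e & Q e.
Proof. by move=> [e0 e0_gt0 h]; exists (e0 / 2); [lra|apply: h; lra]. Qed.

Lemma small_and Q1 Q2 : small Q1 -> small Q2 -> small (fun e => Q1 e /\ Q2 e).
Proof.
move=> [a a0 ha] [b b0 hb]; exists (Num.min a b); first by rewrite lt_min a0 b0.
by move=> e; rewrite lt_min => /and3P[e0 ea eb]; split; [apply: ha|apply: hb]; rewrite e0.
Qed.

Lemma small_all_seq (I : eqType) (s : seq I) (Q : I -> R -> Prop) :
  (forall i, i \in s -> small (Q i)) -> small (fun e => forall i, i \in s -> Q i e).
Proof.
elim: s => [|i s IH] h; first by exists 1 => // e _ i; rewrite in_nil.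
have [] := small_and (h i (mem_head _ _)) (IH (fun j js => h j (mem_behead (s := i :: s) js))).
move=> e0 e0_gt0 H; exists e0 => // e /H[Qi Qs] j; rewrite inE => /predU1P[->//|].
exact: Qs.
Qed.

Lemma small_all (I : finType) (Q : I -> R -> Prop) :
  (forall i, small (Q i)) -> small (fun e => forall i, Q i e).
Proof.
move=> h; have [] := @small_all_seq I (enum I) Q (fun i _ => h i).
by move=> e0 e0_gt0 H; exists e0 => // e /H Qe i; apply: Qe; rewrite mem_enum.
Qed.

Lemma small_imp (A : bool) (Q : R -> Prop) :
  (A -> small Q) -> small (fun e => A -> Q e).
Proof. by case: A => [/(_ isT) [e0 ? h]|_]; [exists e0 => // e /h|exists 1]. Qed.

Lemma small_sub (Q1 Q2 : R -> Prop) :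
  (forall e, 0 < e -> Q1 e -> Q2 e) -> small Q1 -> small Q2.
Proof. by move=> h [e0 ? H]; exists e0 => // e /[dup] /andP[? _] /H; apply: h. Qed.

Lemma small_pos (a b c d : R) : 0 < a ->
  small (fun e => 0 < a + e * (b + e * (c + e * d))).
Proof.
move=> a0; pose M := `|b| + `|c| + `|d| + 1.
have M0 : 0 < M by rewrite /M; have := normr_ge0 b; have := normr_ge0 c; have := normr_ge0 d; lra.
exists (Num.min 1 (a / M)); first by rewrite lt_min ltr01 divr_gt0.
move=> e; rewrite lt_min => /and3P[e0 e1]; rewrite ltr_pdivlMr // => eM.
have h (x : R) : - `|x| <= x by have := ler_norm (- x); rewrite normrN; lra.
have nb := h b; have nc := h c; have nd := h d.
have h1 : - (`|c| + `|d|) <= c + e * d.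
  have : - `|d| <= e * d by have := normr_ge0 d; nra.
  by lra.
have h2 : - (`|b| + (`|c| + `|d|)) <= b + e * (c + e * d).
  have : - (`|c| + `|d|) <= e * (c + e * d).
    by have := normr_ge0 c; have := normr_ge0 d; nra.
  by lra.
have : - (e * M) < e * (b + e * (c + e * d)) by rewrite /M; nra.
lra.
Qed.

Lemma small_sg (a b c d : R) : a != 0 ->
  small (fun e => Num.sg (a + e * (b + e * (c + e * d))) = Num.sg a).
Proof.
rewrite neq_lt => /orP[a0|a0].
  have a0' : 0 < - a by lra.
  apply: small_sub (small_pos (- b) (- c) (- d) a0') => e _ h.
  by rewrite (ltr0_sg a0) ltr0_sg //; lra.
apply: small_sub (small_pos b c d a0) => e _ h.
by rewrite (gtr0_sg a0) gtr0_sg.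
Qed.

End Small.

Section Points.
Variable R : realFieldType.
Local Notation pt := (R * R * R)%type.

Definition dot (u v : pt) : R := u.1.1 * v.1.1 + u.1.2 * v.1.2 + u.2 * v.2.
Definition vprod (u v : pt) : pt :=
  (u.1.2 * v.2 - u.2 * v.1.2, u.2 * v.1.1 - u.1.1 * v.2, u.1.1 * v.1.2 - u.1.2 * v.1.1).
Definition det3 (u v w : pt) : R := dot (vprod u v) w.
Definition translate (u : pt) (e : R) (d : pt) : pt :=
  (u.1.1 + e * d.1.1, u.1.2 + e * d.1.2, u.2 + e * d.2).

Lemma dot_gt0 (u : pt) : u != 0 -> 0 < dot u u.
Proof.
case: u => [[a b] c]; rewrite /dot /= => h.
have a2 := sqr_ge0 a; have b2 := sqr_ge0 b; have c2 := sqr_ge0 c.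
rewrite !expr2 in a2 b2 c2.
rewrite lt_neqAle; apply/andP; split; last by lra.
apply: contra h => /eqP h.
have z x : x * x = 0 :> R -> x = 0 by move/eqP; rewrite mulf_eq0 orbb => /eqP.
have a0 : a = 0 by apply: z; lra.
have b0 : b = 0 by apply: z; lra.
have c0 : c = 0 by apply: z; lra.
by rewrite a0 b0 c0.
Qed.

(** If the vector found so far is orthogonal to the new normal, moving it slightly along that normal
    repairs this and keeps the finitely many other inner products nonzero. *)
Lemma avoid (ns : seq pt) : {in ns, forall n, n != 0} ->
  exists u, {in ns, forall n, dot n u != 0}.
Proof.
elim: ns => [|n ns IH] h; first by exists 0.
have [u hu] := IH (fun m ms => h m (mem_behead (s := n :: ns) ms)).
have n0 := dot_gt0 (h n (mem_head _ _)).
have [nu0|nu0] := eqVneq (dot n u) 0; last first.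
  by exists u => m; rewrite inE => /predU1P[->//|]; apply: hu.
have [e e0 he] := small_ex (small_all_seq (fun m (ms : m \in ns) =>
  small_sg (dot m n) 0 0 (hu m ms))).
exists (translate u e n) => m; rewrite inE => /predU1P[->|ms].
  have -> : dot n (translate u e n) = dot n u + e * dot n n by rewrite /dot /translate /=; ring.
  by rewrite nu0 add0r mulf_neq0 // gt_eqF.
have -> : dot m (translate u e n) = dot m u + e * (dot m n + e * (0 + e * 0)).
  by rewrite /dot /translate /=; ring.
by rewrite -sgr_eq0 he // sgr_eq0 hu.
Qed.

(** The first two conditions say that the plane of each arc separates the ends of the other. This
    still allows one arc to meet the antipode of the other, which the third condition excludes. *)
Definition crossb (a b c d : pt) : bool :=
  [&& det3 a b c * det3 a b d < 0, det3 c d a * det3 c d b < 0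
    & det3 a b c * det3 c d a < 0].

Lemma det3C12 a b c : det3 b a c = - det3 a b c.
Proof. by rewrite /det3 /dot /vprod /=; ring. Qed.
Lemma det3C23 a b c : det3 a c b = - det3 a b c.
Proof. by rewrite /det3 /dot /vprod /=; ring. Qed.
Lemma det3_rot a b c : det3 b c a = det3 a b c.
Proof. by rewrite /det3 /dot /vprod /=; ring. Qed.
Lemma det3_eq12 a b : det3 a a b = 0.
Proof. by rewrite /det3 /dot /vprod /=; ring. Qed.
Lemma det3_eq13 a b : det3 a b a = 0.
Proof. by rewrite /det3 /dot /vprod /=; ring. Qed.
Lemma det3_eq23 a b : det3 a b b = 0.
Proof. by rewrite /det3 /dot /vprod /=; ring. Qed.

Lemma crossbCl a b c d : crossb b a c d = crossb a b c d.
Proof.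
rewrite /crossb (det3C12 a b c) (det3C12 a b d) mulrNN.
apply/and3P/and3P => -[h1 h2 h3]; split => //.
- by rewrite mulrC.
- nra.
- by rewrite mulrC.
- nra.
Qed.

Lemma crossbC a b c d : crossb c d a b = crossb a b c d.
Proof. by rewrite /crossb andbCA [det3 c d a * det3 a b c]mulrC. Qed.

Lemma crossbCr a b c d : crossb a b d c = crossb a b c d.
Proof. by rewrite crossbC crossbCl crossbC. Qed.

Lemma crossb_eq13 a b d : crossb a b a d = false.
Proof. by rewrite /crossb det3_eq13 mul0r ltxx. Qed.

Lemma crossb_eq23 a b d : crossb a b b d = false.
Proof. by rewrite crossbCl crossb_eq13. Qed.

Lemma crossb_eq14 a b c : crossb a b c a = false.
Proof. by rewrite crossbCr crossb_eq13. Qed.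

Lemma crossb_eq24 a b c : crossb a b c b = false.
Proof. by rewrite crossbCr crossb_eq23. Qed.

Lemma crossb_sg a b c d a' b' c' d' :
  Num.sg (det3 a b c) = Num.sg (det3 a' b' c') ->
  Num.sg (det3 a b d) = Num.sg (det3 a' b' d') ->
  Num.sg (det3 c d a) = Num.sg (det3 c' d' a') ->
  Num.sg (det3 c d b) = Num.sg (det3 c' d' b') ->
  crossb a b c d = crossb a' b' c' d'.
Proof.
move=> h1 h2 h3 h4.
by rewrite /crossb -![_ * _ < 0]sgr_lt0 !sgrM h1 h2 h3 h4.
Qed.

End Points.

(** * Halving the edges at a vertex by a great circle *)

Section Halving.
Variables (R : realFieldType) (T : finType).

Lemma separating_point (A : pred T) (m : T -> R) (L : {set T}) :
  {in L, forall y z, A z -> z \notin L -> m y < m z} ->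
  exists mu, {in L, forall y, m y < mu} /\ forall z, A z -> z \notin L -> mu < m z.
Proof.
move=> h.
have le_sum y : `|m y| <= \sum_z `|m z|.
  by rewrite (bigD1 y) //= lerDl sumr_ge0.
have [y0 y0L|L0] := pickP (mem L); last first.
  exists (- \sum_z `|m z| - 1); split=> [y yL|z _ _].
    by have := L0 y; rewrite /= yL.
  by have := le_sum z; have := ler_norm (- m z); rewrite normrN; lra.
have [z0 /andP[z0A z0L]|C0] := pickP [pred z | A z & z \notin L]; last first.
  exists (\sum_z `|m z| + 1); split=> [y _|z zA zL].
    by have := le_sum y; have := ler_norm (m y); lra.
  by have := C0 z; rewrite /= zA zL.
case: (@arg_maxP _ _ T y0 (mem L) m y0L) => y1 y1L y1max.
have z0P : A z0 && (z0 \notin L) by rewrite z0A.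
case: (@arg_minP _ _ T z0 [pred z | A z & z \notin L] m z0P) => z1 /andP[z1A z1L] z1min.
have yz := h _ y1L _ z1A z1L.
exists ((m y1 + m z1) / 2); split=> [y yL|z zA zL].
  by have : m y <= m y1 := y1max _ yL; lra.
have le : m z1 <= m z by apply: z1min; rewrite /= zA.
lra.
Qed.

(* A discrete intermediate value argument: enlarging a lower set by one element
   moves the signed weight by at most 4, and complementing reverses its sign. *)
Lemma balanced_cut (A : pred T) (m : T -> R) (c : pred T) (w : T -> nat) :
  {in A &, injective m} -> (forall y, (w y <= 2)%N) -> (forall y, ~~ A y -> w y = 0%N) ->
  exists L : {set T}, {in L, forall y z, A z -> z \notin L -> m y < m z} /\
   ((\sum_(y | (y \in L) == c y) w y <= \sum_(y | (y \in L) != c y) w y + 2)%N /\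
    (\sum_(y | (y \in L) != c y) w y <= \sum_(y | (y \in L) == c y) w y + 2)%N).
Proof.
move=> mI w2 wA.
pose lower (L : {set T}) := {in L, forall y z, A z -> z \notin L -> m y < m z}.
pose low (L : {set T}) := (L \subset A) &&
  [forall y in L, forall z, A z ==> (z \notin L) ==> (m y < m z)].
have lowP (L : {set T}) : reflect (L \subset A /\ lower L) (low L).
  apply: (iffP andP) => -[LA h]; split=> //.
    move=> y yL z zA zL.
    by have /forall_inP/(_ y yL)/forallP/(_ z)/implyP/(_ zA)/implyP := h; apply.
  apply/forall_inP => y yL; apply/forallP => z; apply/implyP => zA; apply/implyP => zL.
  exact: h.
pose g (c : pred T) (L : {set T}) := (\sum_(y | (y \in L) == c y) w y)%N.
pose g' (c : pred T) (L : {set T}) := (\sum_(y | (y \in L) != c y) w y)%N.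
have tot c' (L : {set T}) : (g c' L + g' c' L = \sum_y w y)%N.
  by rewrite [RHS](bigID (fun y => (y \in L) == c' y)).
pose SA := [set y | A y].
have lowA : low SA.
  apply/lowP; split; first by apply/subsetP => y; rewrite inE.
  by move=> y _ z zA; rewrite inE zA.
wlog gT : c / (g' c SA <= g c SA)%N.
  move=> H; have [|lt] := leqP (g' c SA) (g c SA); first exact: H.
  have sw (L : {set T}) : g [pred y | ~~ c y] L = g' c L /\ g' [pred y | ~~ c y] L = g c L.
    by split; apply: eq_bigl => y /=; case: (y \in L); case: (c y).
  case: (H [pred y | ~~ c y]) => [|L [hL [h1 h2]]].
    by case: (sw SA) => -> ->; apply: ltnW.
  by exists L; split=> //; case: (sw L); rewrite /g /g' => <- <-.
have PT : low SA && (g' c SA <= g c SA)%N by rewrite lowA.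
(* In a smallest lower set with nonnegative signed weight, dropping the greatest element makes that
   weight negative. The two values differ by at most 4, so one of the two sets is within 2 of
   balance. *)
case: (@arg_minnP _ SA (fun L => low L && (g' c L <= g c L)%N) (fun L => #|L|) PT).
move=> L /andP[/lowP[LA Llow] Lg] Lmin.
have [y0 y0L|L0] := pickP (mem L); last first.
  (* The empty set and all of [A] have opposite signed weights; here neither is negative, so both
     vanish. *)
  have Le : L = set0 by apply/setP => y; rewrite inE; apply: L0.
  have e1 : g c set0 = g' c SA.
    rewrite /g /g' [LHS]big_mkcond [RHS]big_mkcond; apply: eq_bigr => y _; rewrite !inE.
    by have [Ay|Ay] := boolP (A y); [case: (c y)|rewrite wA // !if_same].
  have e2 : g' c set0 = g c SA.
    rewrite /g /g' [LHS]big_mkcond [RHS]big_mkcond; apply: eq_bigr => y _; rewrite !inE.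
    by have [Ay|Ay] := boolP (A y); [case: (c y)|rewrite wA // !if_same].
  exists set0; split; first by move=> y; rewrite inE.
  by rewrite -/(g c set0) -/(g' c set0) e1 e2; rewrite Le e1 e2 in Lg; lia.
case: (@arg_maxP _ _ T y0 (mem L) m y0L) => y1 y1L' y1max.
have y1L : y1 \in L := y1L'.
have AL y : y \in L -> A y by move/(subsetP LA).
pose L' := L :\ y1.
have low' : low L'.
  apply/lowP; split; first exact: subset_trans (subsetDl _ _) LA.
  move=> y; rewrite !inE => /andP[yy1 yL] z zA; rewrite !inE negb_and negbK.
  case/orP => [/eqP ->|]; last exact: Llow.
  have le : m y <= m y1 := y1max _ yL.
  rewrite lt_neqAle le andbT; apply: contra yy1 => /eqP /mI -> //; exact: AL.
have dg : (g c L <= g c L' + 2)%N.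
  rewrite /g (bigID (pred1 y1)) [X in (_ <= X + _)%N](bigID (pred1 y1)) /=.
  have -> : (\sum_(i | ((i \in L') == c i) && (i != y1)) w i =
             \sum_(i | ((i \in L) == c i) && (i != y1)) w i)%N.
    by apply: eq_bigl => y; rewrite !inE; case: (y == y1); rewrite ?andbF.
  suff : (\sum_(i | ((i \in L) == c i) && (i == y1)) w i <= 2)%N by lia.
  have [cy|cy] := boolP ((y1 \in L) == c y1).
    by rewrite (big_pred1 y1) // => y /=; case: (eqVneq y y1) => [->|]; rewrite ?cy ?andbF.
  by rewrite big_pred0 // => y; case: (eqVneq y y1) => [->|]; rewrite ?(negbTE cy) ?andbF.
have Lg' : (g c L' < g' c L')%N.
  rewrite ltnNge; apply/negP => le.
  have /Lmin : low L' && (g' c L' <= g c L')%N by rewrite low'.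
  by rewrite (cardsD1 y1 L) y1L /L'; lia.
have tL := tot c L; have tL' := tot c L'.
have [s|s] := leqP (g c L) (g' c L + 2).
  exists L; split=> //.
  by rewrite -/(g c L) -/(g' c L); lia.
exists L'; split; first by case/lowP: low'.
by rewrite -/(g c L') -/(g' c L'); lia.
Qed.

End Halving.

Section Direction.
Variables (R : realFieldType) (V : finType).
Local Notation pt := (R * R * R)%type.

Definition generic (P : V -> pt) :=
  forall x y z, x != y -> y != z -> x != z -> det3 (P x) (P y) (P z) != 0.

Lemma third_point (x y : V) : (2 < #|V|)%N -> exists z, (x != z) && (y != z).
Proof.
move=> V2; have : (0 < #|~: [set x; y]|)%N.
  by have := cardsC [set x; y]; rewrite cards2; move: V2; case: (x != y) => /=; lia.
by case/card_gt0P => z; rewrite !inE negb_or ![z == _]eq_sym => h; exists z.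
Qed.

Lemma vprod_neq0 (u v d : pt) : det3 u v d != 0 -> vprod u v != 0.
Proof. by apply: contraNneq; rewrite /det3 => ->; rewrite /dot /= !mul0r !addr0. Qed.

(** The great circles through [P x] form a pencil [d1 + mu d2], along which the determinant equals
    [be y * (mu - m y)]: as [mu] grows, the circle passes the other vertices one at a time in the
    order of their slopes [m y]. The vertices passed form a lower set, coloured by the sign of [be],
    and [balanced_cut] says where to stop. The vertex [x] itself is counted on the nonpositive side,
    with weight 0. *)
Lemma halving_direction (P : V -> pt) (x : V) (w : V -> nat) :
  (2 < #|V|)%N -> generic P -> (forall y, (w y <= 2)%N) -> w x = 0%N ->
  exists d, (forall y, y != x -> det3 (P x) (P y) d != 0) /\
   ((\sum_(y | (0 < det3 (P x) (P y) d)%R) w y <=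
     \sum_(y | ~~ (0 < det3 (P x) (P y) d)%R) w y + 2)%N /\
    (\sum_(y | ~~ (0 < det3 (P x) (P y) d)%R) w y <=
     \sum_(y | (0 < det3 (P x) (P y) d)%R) w y + 2)%N).
Proof.
move=> V2 gP w2 wx.
have [d2 hd2] : exists d2, forall y, y != x -> det3 (P x) (P y) d2 != 0.
  have [|u hu] := @avoid _ [seq vprod (P x) (P y) | y <- enum V & y != x].
    move=> n /mapP[y]; rewrite mem_filter => /andP[yx _] ->.
    have [z /andP[xz yz]] := third_point x y V2.
    by apply: (@vprod_neq0 _ _ (P z)); apply: gP => //; rewrite eq_sym.
  exists u => y yx; apply: hu; apply: map_f.
  by rewrite mem_filter yx mem_enum.
have [d1 hd1] : exists d1, det3 d2 (P x) d1 != 0.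
  have [y0 /andP[xy0 _]] := third_point x x V2.
  have [|u hu] := @avoid _ [:: vprod d2 (P x)].
    move=> n; rewrite inE => /eqP ->; apply: (@vprod_neq0 _ _ (P y0)).
    by rewrite -det3_rot; apply: hd2; rewrite eq_sym.
  by exists u; apply: hu; rewrite inE.
pose be y := det3 (P x) (P y) d2; pose al y := det3 (P x) (P y) d1.
pose m y := - al y / be y.
have mI : {in [pred y | y != x] &, injective m}.
  move=> y z /= yx zx; rewrite !inE in yx zx; move=> e; apply/eqP; apply/negPn/negP => yz.
  have b1 : be y != 0 := hd2 _ yx. have b2 : be z != 0 := hd2 _ zx.
  have e2 : al y * be z = al z * be y.
    have := congr1 (fun t => - (t * be y * be z)) e.
    by rewrite /m mulfVK // mulrAC mulfVK // !mulNr !opprK mulrC [RHS]mulrC.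
  (* Equal slopes would make this product of two nonzero determinants vanish; the alternative only
     leaves its sign open. *)
  have : det3 d2 (P x) d1 * det3 (P x) (P y) (P z) = al y * be z - al z * be y \/
         det3 d2 (P x) d1 * det3 (P x) (P y) (P z) = - (al y * be z - al z * be y).
    by rewrite /al /be /det3 /dot /vprod /=; (left; ring) || (right; ring).
  rewrite e2 subrr oppr0 => h; have : det3 d2 (P x) d1 * det3 (P x) (P y) (P z) = 0 by case: h.
  by apply/eqP; rewrite mulf_neq0 //; apply: gP => //; rewrite eq_sym.
have [|L [hL cut]] := balanced_cut (A := [pred y | y != x]) (m := m)
  (fun y => (0 < be y)) (w := w) mI w2.
  by move=> y /=; rewrite negbK => /eqP ->.
have [mu [mu1 mu2]] := separating_point hL.
exists (translate d1 mu d2).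
have E y : det3 (P x) (P y) (translate d1 mu d2) = al y + mu * be y.
  by rewrite /al /be /det3 /dot /translate /=; ring.
have Em y : y != x -> al y + mu * be y = be y * (mu - m y).
  by move=> yx; rewrite /m; field; apply: hd2.
have side y : y != x -> (det3 (P x) (P y) (translate d1 mu d2) != 0) /\
    (0 < det3 (P x) (P y) (translate d1 mu d2)) = ((y \in L) == (0 < be y)).
  move=> yx; rewrite E Em //; have b0 := hd2 _ yx; rewrite -/(be y) in b0.
  have [yL|yL] := boolP (y \in L).
    have := mu1 _ yL; rewrite -subr_gt0 => h.
    by rewrite mulf_neq0 ?(gt_eqF h) // pmulr_lgt0 //; case: (0 < be y).
  have := mu2 _ yx yL; rewrite -subr_lt0 => h.
  rewrite mulf_neq0 ?(lt_eqF h) // nmulr_lgt0 // ltNge le_eqVlt eq_sym (negbTE b0) /=.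
  by case: (0 < be y).
split; first by move=> y /side[].
have e1 : (\sum_(y | (0 < det3 (P x) (P y) (translate d1 mu d2))%R) w y =
           \sum_(y | (y \in L) == (0 < be y)%R) w y)%N.
  rewrite [LHS]big_mkcond [RHS]big_mkcond; apply: eq_bigr => y _.
  by have [->|yx] := eqVneq y x; [rewrite wx !if_same|rewrite (side _ yx).2].
have e2 : (\sum_(y | ~~ (0 < det3 (P x) (P y) (translate d1 mu d2))%R) w y =
           \sum_(y | (y \in L) != (0 < be y)%R) w y)%N.
  rewrite [LHS]big_mkcond [RHS]big_mkcond; apply: eq_bigr => y _.
  by have [->|yx] := eqVneq y x; [rewrite wx !if_same|rewrite (side _ yx).2].
by rewrite e1 e2.
Qed.

End Direction.

(** The two sides have weights [k + r] and [k - r], where [r <= 1] because their difference is even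
    and at most 2; so their squares add up to at most [2k^2 + 2], from which the diagonal removes
    [2k + 4]. *)
Lemma same_side_sum (V : finType) (w : V -> nat) (a : pred V) (k : nat) :
  (\sum_y w y = k.*2)%N -> (\sum_y w y ^ 2 = k.*2 + 4)%N ->
  (\sum_(y | a y) w y <= \sum_(y | ~~ a y) w y + 2)%N ->
  (\sum_(y | ~~ a y) w y <= \sum_(y | a y) w y + 2)%N ->
  (\sum_y \sum_(t | t != y) (a y == a t) * (w y * w t) + (k.*2 + 2) <= 2 * k ^ 2)%N.
Proof.
set p := (\sum_(y | a y) w y)%N; set q := (\sum_(y | ~~ a y) w y)%N => s1 s2 h1 h2.
have pq : (p + q = k.*2)%N by rewrite -s1 [RHS](bigID a).
have tot : (\sum_y \sum_t (a y == a t) * (w y * w t) = p * p + q * q)%N.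
  have Es (b : bool) : (\sum_(t | a t == b) w t = if b then p else q)%N.
    by case: b; apply: eq_bigl => t; case: (a t).
  rewrite (eq_bigr (fun y => w y * (if a y then p else q)))%N; last first.
    move=> y _; rewrite -Es big_distrr /= big_mkcond [RHS]big_mkcond; apply: eq_bigr => t _.
    by rewrite /= [a t == _]eq_sym; case: (a y == a t); rewrite ?mul1n ?mul0n.
  rewrite (bigID a) /=; congr (_ + _)%N; rewrite big_distrl /=; apply: eq_bigr => y ay.
    by rewrite ay.
  by rewrite (negbTE ay).
have : (p * p + q * q = \sum_y \sum_(t | t != y) (a y == a t) * (w y * w t) + (k.*2 + 4))%N.
  rewrite -tot -s2 -big_split /=; apply: eq_bigr => y _.
  by rewrite (bigD1 y) //= eqxx mul1n addnC.
have : (p * p + q * q <= 2 * k ^ 2 + 2)%N.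
  rewrite !mulnn.
  have [r [e1 e2]] : exists r,
    (p = k + r /\ q = k - r \/ q = k + r /\ p = k - r)%N /\ (r <= 1)%N /\ (r <= k)%N.
    by exists (maxn p q - k)%N; lia.
  case: e1 => -[-> ->]; move: e2 => [r1 rk]; rewrite -(subnKC rk); move: (k - r)%N => j;
    rewrite addKn; clear -r1; case: r r1 => [|[|]] // _; nia.
lia.
Qed.

(** * Doubling a drawing *)

Section Crossings.
Variables (R : realFieldType) (V : finType).
Local Notation pt := (R * R * R)%type.

(* Each unordered pair of crossing edges is counted eight times. *)
Definition ncross (P : V -> pt) (w : V -> V -> nat) : nat :=
  (\sum_x \sum_y \sum_z \sum_t
     w x y * w z t * crossb (P x) (P y) (P z) (P t))%N.
End Crossings.

Section Doubling.
Variables (R : realFieldType) (V : finType).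
Local Notation pt := (R * R * R)%type.

Definition split_point (P : V -> pt) (d : V -> pt) (e : R) (p : V * bool) : pt :=
  translate (P p.1) (if p.2 then e else - e) (d p.1).

Lemma det3C13 (a b c : pt) : det3 c b a = - det3 a b c.
Proof. by rewrite det3C12 det3_rot. Qed.

Lemma det3_shift1 (u v w a : pt) (e : R) :
  det3 (translate u e a) v w = det3 u v w + e * det3 a v w.
Proof. by rewrite /det3 /dot /vprod /translate /=; ring. Qed.

Lemma det3_shift2 (u v w a : pt) (e : R) :
  det3 u (translate v e a) w = det3 u v w + e * det3 u a w.
Proof. by rewrite -!(det3_rot u) det3_shift1. Qed.

Lemma det3_shift3 (u v w a : pt) (e : R) :
  det3 u v (translate w e a) = det3 u v w + e * det3 u v a.
Proof. by rewrite !(det3_rot _ u v) det3_shift1. Qed.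

Lemma det3_shift (u v w a b c : pt) (e : R) :
  det3 (translate u e a) (translate v e b) (translate w e c) =
  det3 u v w + e * (det3 a v w + det3 u b w + det3 u v c
    + e * (det3 a b w + det3 a v c + det3 u b c + e * det3 a b c)).
Proof. by rewrite !(det3_shift1, det3_shift2, det3_shift3); ring. Qed.

Lemma split_pointE (P d : V -> pt) (e : R) (p : V * bool) :
  split_point P d e p = translate (P p.1) e (translate 0 (if p.2 then 1 else -1) (d p.1)).
Proof.
by rewrite /split_point /translate /=; case: p.2; rewrite ?mul1r ?mulN1r ?add0r ?mulNr ?mulrN.
Qed.

Lemma det3_split (P d : V -> pt) (p q r : V * bool) :
  exists b c f, forall e,
    det3 (split_point P d e p) (split_point P d e q) (split_point P d e r) =
    det3 (P p.1) (P q.1) (P r.1) + e * (b + e * (c + e * f)).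
Proof.
by do 3!eexists; move=> e; rewrite !split_pointE; apply: det3_shift.
Qed.

(** The constant term contains [P x] twice and vanishes; the sign for small [e] is thus that of the
    linear term, which tells the side of the halving circle at [x] on which [P y] lies. *)
Lemma det3_split_twin (P d : V -> pt) (x y : V) (i j : bool) :
  exists b c, forall e, det3 (split_point P d e (x, i)) (split_point P d e (y, j))
    (split_point P d e (x, ~~ i)) =
  2 * e * ((if i then - det3 (P x) (P y) (d x) else det3 (P x) (P y) (d x))
           + e * (b + e * (c + e * 0))).
Proof.
pose s (i : bool) : R := if i then 1 else - 1.
exists (- (s i * s j * det3 (P x) (d y) (d x))), 0 => e; rewrite /split_point /s /=.
rewrite !(det3_shift1, det3_shift2, det3_shift3) !(det3_eq12, det3_eq13, det3_eq23).
rewrite !(det3C13 (P x) _ (d x)).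
by case: i; case: j => /=; ring.
Qed.

Lemma small_split (P d : V -> pt) :
  generic P -> (forall x y, y != x -> det3 (P x) (P y) (d x) != 0) ->
  small (fun e =>
    (forall p q r : V * bool, p.1 != q.1 -> q.1 != r.1 -> p.1 != r.1 ->
      Num.sg (det3 (split_point P d e p) (split_point P d e q) (split_point P d e r)) =
      Num.sg (det3 (P p.1) (P q.1) (P r.1))) /\
    (forall x y i j, y != x ->
      Num.sg (det3 (split_point P d e (x, i)) (split_point P d e (y, j))
                (split_point P d e (x, ~~ i))) =
      Num.sg (if i then - det3 (P x) (P y) (d x) else det3 (P x) (P y) (d x)))).
Proof.
move=> gP hd; apply: small_and.
  apply: small_all => p; apply: small_all => q; apply: small_all => r.
  apply: small_imp => pq; apply: small_imp => qr; apply: small_imp => pr.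
  have [b [c [f E]]] := det3_split P d p q r.
  by apply: small_sub (small_sg b c f (gP _ _ _ pq qr pr)) => e _ <-; rewrite E.
apply: small_all => x; apply: small_all => y; apply: small_all => i; apply: small_all => j.
apply: small_imp => yx; have [b [c E]] := det3_split_twin P d x y i j.
have D0 : (if i then - det3 (P x) (P y) (d x) else det3 (P x) (P y) (d x)) != 0.
  by case: i {E}; rewrite ?oppr_eq0 hd.
apply: small_sub (small_sg b c 0 D0) => e e0 <-; rewrite E sgrM.
by rewrite [Num.sg (2 * e)]gtr0_sg ?mul1r // mulr_gt0.
Qed.

Section Step.
Variables (P d : V -> pt) (w : V -> V -> nat) (w' : V * bool -> V * bool -> nat).
Variable e : R.
Local Notation P' := (split_point P d e).
Hypothesis gP : generic P.
Hypothesis hd : forall x y, y != x -> det3 (P x) (P y) (d x) != 0.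
Hypothesis sg_far : forall p q r : V * bool, p.1 != q.1 -> q.1 != r.1 -> p.1 != r.1 ->
  Num.sg (det3 (P' p) (P' q) (P' r)) = Num.sg (det3 (P p.1) (P q.1) (P r.1)).
Hypothesis sg_twin : forall x y i j, y != x ->
  Num.sg (det3 (P' (x, i)) (P' (y, j)) (P' (x, ~~ i))) =
  Num.sg (if i then - det3 (P x) (P y) (d x) else det3 (P x) (P y) (d x)).
Hypothesis w'C : forall p q, w' p q = w' q p.
Hypothesis w'w : forall x y i, x != y -> (w' (x, i) (y, false) + w' (x, i) (y, true) = w x y)%N.
Hypothesis w'N : forall x y i j, w' (x, ~~ i) (y, ~~ j) = w' (x, i) (y, j).

Lemma generic_split : generic P'.
Proof.
have tw x i y j : y != x -> det3 (P' (x, i)) (P' (y, j)) (P' (x, ~~ i)) != 0.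
  move=> yx; rewrite -sgr_eq0 sg_twin // sgr_eq0.
  by case: i; rewrite ?oppr_eq0 hd.
have tw' x i i' y j : y != x -> (x, i) != (x, i') ->
    det3 (P' (x, i)) (P' (y, j)) (P' (x, i')) != 0.
  move=> yx; rewrite xpair_eqE eqxx /= => ii'.
  by have -> : i' = ~~ i; [case: i i' ii' => -[]|apply: tw].
move=> [x i] [y j] [z l] pq qr pr.
have [xy|xy] := eqVneq x y; last have [yz|yz] := eqVneq y z; last have [xz|xz] := eqVneq x z.
- subst y; have zx : z != x.
    apply/eqP => zx; subst z; move: pq qr pr; clear; rewrite !xpair_eqE eqxx /=.
    by case: i j l => -[] [].
  by rewrite det3C23 oppr_eq0; apply: tw'.
- subst z; rewrite det3C12 oppr_eq0; apply: tw' => //.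
- by subst z; apply: tw' => //; rewrite eq_sym.
- by rewrite -sgr_eq0 sg_far // sgr_eq0 gP.
Qed.

(** Sorting the new crossings by the pair of old edges below them leaves one case for each way in
    which these two edges can overlap. *)
Definition block (x y z t : V) : nat := (\sum_i \sum_j \sum_k \sum_l
  w' (x, i) (y, j) * w' (z, k) (t, l) * crossb (P' (x, i)) (P' (y, j)) (P' (z, k)) (P' (t, l)))%N.

Lemma blockC x y z t : block z t x y = block x y z t.
Proof.
rewrite /block; under eq_bigr do rewrite exchange_big /=.
rewrite exchange_big /=; under eq_bigr do under eq_bigr do rewrite exchange_big /=.
under eq_bigr do rewrite exchange_big /=.
by do 4![apply: eq_bigr => ? _]; rewrite crossbC mulnAC [in RHS]mulnAC [RHS]mulnAC mulnC mulnA.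
Qed.

Lemma blockCl x y z t : block y x z t = block x y z t.
Proof.
rewrite /block exchange_big /=; do 4![apply: eq_bigr => ? _].
by rewrite w'C crossbCl.
Qed.

Lemma blockCr x y z t : block x y t z = block x y z t.
Proof. by rewrite blockC blockCl blockC. Qed.

(** No determinant changes sign, so all strands cross as the old edges do; the strands over an edge
    have twice its weight in total, whence the factor 4. *)
Lemma block_far x y z t : x != y -> z != t -> x != z -> x != t -> y != z -> y != t ->
  block x y z t = (4 * (w x y * w z t * crossb (P x) (P y) (P z) (P t)))%N.
Proof.
move=> xy zt xz xt yz yt; rewrite /block.
have E i j k l : crossb (P' (x, i)) (P' (y, j)) (P' (z, k)) (P' (t, l)) =
    crossb (P x) (P y) (P z) (P t).
  by apply: crossb_sg; rewrite sg_far //= eq_sym.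
under eq_bigr do under eq_bigr do under eq_bigr do under eq_bigr do rewrite E.
have h1 := w'w true xy; have h2 := w'w false xy.
have h3 := w'w true zt; have h4 := w'w false zt.
rewrite !big_bool /=; move: h1 h2 h3 h4; set X := nat_of_bool _.
move: (w' (x, true) _) (w' (x, true) _) (w' (x, false) _) (w' (x, false) _) => n1 n2 n3 n4.
move: (w' (z, true) _) (w' (z, true) _) (w' (z, false) _) (w' (z, false) _) => m1 m2 m3 m4.
move=> <- h2 <- h4.
have -> : (4 * ((n2 + n1) * (m2 + m1) * X)
  = ((n2 + n1) + (n2 + n1)) * ((m2 + m1) + (m2 + m1)) * X)%N by ring.
by rewrite -{2}h2 -{2}h4; ring.
Qed.

(** Twins lie on the same side of every plane through two points coming from other, different
    vertices, and another pair of twins lies on one side of their own plane; so the short edge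
    between twins is crossed by nothing. *)
Lemma block_loop x z t : block x x z t = 0%N.
Proof.
rewrite /block; apply: big1 => i _; apply: big1 => j _; apply: big1 => k _; apply: big1 => l _.
suff -> : crossb (P' (x, i)) (P' (x, j)) (P' (z, k)) (P' (t, l)) = false by rewrite muln0.
have [->|ij] := eqVneq i j.
  by rewrite /crossb !det3_eq12 mul0r ltxx.
have {ij}-> : j = ~~ i by case: i j ij => -[].
have [xz|xz] := eqVneq x z.
  subst z; have [->|ne] := eqVneq k i; first by rewrite crossb_eq13.
  have -> : k = ~~ i by case: i k ne => -[].
  by rewrite crossbCl crossb_eq13.
have [xt|xt] := eqVneq x t.
  subst t; rewrite crossbCr; have [->|ne] := eqVneq l i; first by rewrite crossb_eq13.
  have -> : l = ~~ i by case: i l ne => -[].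
  by rewrite crossbCl crossb_eq13.
have zx : z != x by rewrite eq_sym.
have tx : t != x by rewrite eq_sym.
apply/negbTE/negP; rewrite /crossb => /and3P[]; have [zt|zt] := eqVneq z t.
  subst t => + _ _; rewrite -sgr_lt0 sgrM.
  by rewrite !(det3C23 _ _ (P' (x, ~~ i))) !sgrN !sg_twin // mulrNN -expr2 ltNge sqr_ge0.
by move=> _ + _; rewrite -sgr_lt0 sgrM !sg_far //= -expr2 ltNge sqr_ge0.
Qed.

Definition same_side x y t := (0 < det3 (P x) (P y) (d x)) == (0 < det3 (P x) (P t) (d x)).

(** Strands leaving the same twin do not cross. Strands leaving different twins towards the same
    side of the halving circle cross for at most one of the two assignments of the twins, decided by
    the order of [y] and [t] around [x]; towards different sides they never cross. *)
Lemma crossb_share x y t i j k l : y != x -> t != x -> y != t ->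
  (crossb (P' (x, i)) (P' (y, j)) (P' (x, k)) (P' (t, l)) <=
   (k == ~~ i) && (i == (0 < det3 (P x) (P y) (d x) * det3 (P x) (P y) (P t))%R) &&
   same_side x y t)%N.
Proof.
move=> yx tx yt; case: (boolP (crossb _ _ _ _)) => // C.
have {}ki : k = ~~ i.
  have : k != i by apply: contraTneq C => ->; rewrite crossb_eq13.
  by case: i k {C} => -[].
subst k; rewrite eqxx /= lt0n eqb0 negbK.
have A0 := hd yx; have B0 := hd tx.
have e1 := sg_twin i j yx; have e3 := sg_twin (~~ i) l tx; rewrite negbK in e3.
have xy : x != y by rewrite eq_sym.
have xt : x != t by rewrite eq_sym.
have e2 := @sg_far (x, i) (y, j) (t, l) xy yt xt.
move: C => /and3P[]; rewrite -![_ * _ < 0]sgr_lt0 !sgrM.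
rewrite e1 e2 e3 -!sgrM !sgr_lt0 /= /same_side.
move: A0 B0; move: (det3 (P x) (P y) (d x)) (det3 (P x) (P t) (d x)) (det3 (P x) (P y) (P t)).
move=> a b c A0 B0.
case: i {e1 e2 e3} => /= h1 _ h2; apply/andP; split.
- by rewrite eq_sym eqb_id; lra.
- have h : 0 < a * b by lra.
  by apply/eqP; apply/idP/idP => h'; nra.
- by rewrite eq_sym eqbF_neg -leNgt; lra.
- have h : 0 < a * b by lra.
  by apply/eqP; apply/idP/idP => h'; nra.
Qed.

Lemma block_share x y t : y != x -> t != x -> y != t ->
  (block x y x t <= same_side x y t * (w x y * w x t))%N.
Proof.
move=> yx tx yt; set b0 := (0 < det3 (P x) (P y) (d x) * det3 (P x) (P y) (P t)).
apply: (@leq_trans (\sum_i \sum_j \sum_k \sum_l w' (x, i) (y, j) * w' (x, k) (t, l) *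
   ((k == ~~ i) && (i == b0) && same_side x y t))%N).
  by do 4![apply: leq_sum => ? _]; rewrite leq_mul2l crossb_share ?orbT.
have xy : x != y by rewrite eq_sym.
have xt : x != t by rewrite eq_sym.
(* For the one admissible assignment, all strands from that twin towards [y] have total weight
   [w x y], and those from the other twin towards [t] have [w x t]. *)
rewrite -(w'w b0 xy) -(w'w (~~ b0) xt); case: b0; rewrite !big_bool /= !muln0 !addn0 ?add0n.
  by apply/eq_leq; ring.
by apply/eq_leq; ring.
Qed.

(** Strands over the same edge can cross only if they have no end in common, which pairs each with
    its opposite; by [w'N] opposite strands have equal weight. *)
Lemma block_twin x y : x != y ->
  (block x y x y <= \sum_i \sum_j w' (x, i) (y, j) ^ 2)%N.
Proof.
move=> xy; rewrite /block; apply: leq_sum => i _; apply: leq_sum => j _.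
rewrite (bigD1 (~~ i)) //= [X in (_ + X <= _)%N]big1 ?addn0; last first.
  move=> k ki; have -> : k = i by move: ki; clear; case: i; case: k.
  by apply: big1 => l _; rewrite crossb_eq13 muln0.
rewrite (bigD1 (~~ j)) //= [X in (_ + X <= _)%N]big1 ?addn0; last first.
  move=> l lj; have -> : l = j by move: lj; clear; case: j; case: l.
  by rewrite crossbCl crossbCr crossb_eq13 muln0.
by rewrite w'N mulnn -[leqRHS]muln1 leq_mul2l leq_b1 orbT.
Qed.

End Step.
End Doubling.

Lemma sum_delta (I : finType) (x : I) (G : I -> nat) :
  (\sum_z (x == z) * G z = G x)%N.
Proof.
rewrite (bigD1 x) //= eqxx mul1n big1 ?addn0 // => z zx.
by rewrite eq_sym (negbTE zx).
Qed.

Lemma sum_pair (I J : finType) (F : I * J -> nat) :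
  (\sum_p F p = \sum_i \sum_j F (i, j))%N.
Proof. by rewrite pair_bigA; apply: eq_bigr; case. Qed.

Theorem doubling (R : realFieldType) (V : finType) (P : V -> R * R * R)
  (w : V -> V -> nat) (w' : V * bool -> V * bool -> nat) (k : nat) :
  (2 < #|V|)%N -> generic P ->
  (forall x, w x x = 0)%N -> (forall x y, w x y <= 2)%N ->
  (forall x, \sum_y w x y = k.*2)%N -> (forall x, \sum_y w x y ^ 2 = k.*2 + 4)%N ->
  (forall p q, w' p q = w' q p) ->
  (forall x y i, x != y -> w' (x, i) (y, false) + w' (x, i) (y, true) = w x y)%N ->
  (forall x y i j, w' (x, ~~ i) (y, ~~ j) = w' (x, i) (y, j)) ->
  (forall x i, \sum_(y | y != x) \sum_j w' (x, i) (y, j) ^ 2 <= k.*2 + 2)%N ->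
  exists2 P' : V * bool -> R * R * R, generic P' &
    (ncross P' w' <= 4 * ncross P w + #|V| * (8 * k ^ 2))%N.
Proof.
move=> V2 gP w0 w2 s1 s2 w'C w'w w'N s2'.
have [d hd] := fin_all_exists (fun x => @halving_direction _ _ P x (w x) V2 gP (w2 x) (w0 x)).
have hd0 x y : y != x -> det3 (P x) (P y) (d x) != 0 by move=> yx; have [h _] := hd x; apply: h.
have [e _ [far twin]] := small_ex (small_split gP hd0).
exists (split_point P d e); first exact: generic_split.
pose S x y := (\sum_i \sum_j w' (x, i) (y, j) ^ 2)%N.
pose H x y t := ((t != y) * (same_side P d x y t * (w x y * w x t)))%N.
(* [H] covers the four positions of a single shared end, [S] the two orientations in which both
   edges coincide; for four different vertices only the main term remains. *)
have bound x y z t : (block P d w' e x y z t <=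
    4 * (w x y * w z t * crossb (P x) (P y) (P z) (P t)) +
    ((x == z) * H x y t + (x == t) * H x y z + (y == z) * H y x t + (y == t) * H y x z +
     (x == z) * ((y == t) * ((y != x) * S x y)) + (x == t) * ((y == z) * ((y != x) * S x y))))%N.
  have [->|xy] := eqVneq x y; first by rewrite block_loop.
  have [->|zt] := eqVneq z t; first by rewrite blockC block_loop.
  have yx : y != x by rewrite eq_sym.
  have tz : t != z by rewrite eq_sym.
  have twin_le x' y' : x' != y' -> (block P d w' e x' y' x' y' <= S x' y')%N.
    by move=> h; apply: block_twin.
  have share x' y' t' : y' != x' -> t' != x' -> t' != y' ->
       (block P d w' e x' y' x' t' <= H x' y' t')%N.
    by move=> h1 h2 h3; rewrite /H h3 mul1n block_share // eq_sym.
  have [xz|xz] := eqVneq x z.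
    subst z; have [yt|yt] := eqVneq y t.
      by subst t; have := twin_le x y xy; rewrite ?yx /=; lia.
    by have := share x y t yx tz; rewrite eq_sym yt => /(_ isT); lia.
  have [xt|xt] := eqVneq x t.
    subst t; rewrite blockCr //; have [yz|yz] := eqVneq y z.
      by subst z; have := twin_le x y xy; rewrite ?yx /=; lia.
    by have := share x y z yx zt; rewrite eq_sym yz => /(_ isT); lia.
  have [yz|yz] := eqVneq y z.
    subst z; rewrite blockCl //; have := share y x t xy tz.
    by rewrite eq_sym xt => /(_ isT); lia.
  have [yt|yt] := eqVneq y t.
    subst t; rewrite blockCr // blockCl //; have := share y x z xy zt.
    by rewrite eq_sym xz => /(_ isT); lia.
  by rewrite (block_far far w'w) // leq_addr.
have Kb : ncross (split_point P d e) w' = (\sum_x \sum_y \sum_z \sum_t block P d w' e x y z t)%N.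
  rewrite /ncross sum_pair /=; apply: eq_bigr => x _.
  rewrite /block; under [RHS]eq_bigr do under eq_bigr do rewrite exchange_big /=.
  under [RHS]eq_bigr do rewrite exchange_big /=.
  rewrite [RHS]exchange_big /=; apply: eq_bigr => i _.
  rewrite sum_pair /=; apply: eq_bigr => y _.
  under [RHS]eq_bigr do rewrite exchange_big /=.
  rewrite [RHS]exchange_big /=; apply: eq_bigr => j _.
  rewrite sum_pair /=; apply: eq_bigr => z _.
  rewrite [RHS]exchange_big /=; apply: eq_bigr => l _.
  by rewrite sum_pair.
rewrite Kb.
apply: leq_trans.
  apply: leq_sum => x _; apply: leq_sum => y _; apply: leq_sum => z _; apply: leq_sum => t _.
  exact: bound.
under eq_bigr do under eq_bigr do under eq_bigr do rewrite big_split /= -big_distrr /=.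
under eq_bigr do under eq_bigr do rewrite big_split /= -big_distrr /=.
under eq_bigr do rewrite big_split /= -big_distrr /=.
rewrite big_split /= -big_distrr /= -/(ncross P w) leq_add2l.
have Hx x : (\sum_y \sum_t H x y t + (k.*2 + 2) <= 2 * k ^ 2)%N.
  have [_ [c1 c2]] := hd x.
  have := same_side_sum (s1 x) (s2 x) c1 c2.
  congr (_ + _ <= _)%N; apply: eq_bigr => y _; rewrite /H [LHS]big_mkcond.
  by apply: eq_bigr => t _; case: (t != y); rewrite ?mul1n ?mul0n.
have Sx x : (\sum_y (y != x) * S x y <= 2 * (k.*2 + 2))%N.
  have -> : (\sum_y (y != x) * S x y = \sum_i \sum_(y | y != x) \sum_j w' (x, i) (y, j) ^ 2)%N.
    rewrite [RHS]exchange_big /= [RHS]big_mkcond /=; apply: eq_bigr => y _.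
    by case: (y != x); rewrite ?mul1n ?mul0n.
  by rewrite big_bool mul2n -addnn leq_add ?s2'.
have -> : (\sum_x \sum_y \sum_z \sum_t
    ((x == z) * H x y t + (x == t) * H x y z + (y == z) * H y x t + (y == t) * H y x z +
     (x == z) * ((y == t) * ((y != x) * S x y)) + (x == t) * ((y == z) * ((y != x) * S x y)))
  = \sum_x (4 * (\sum_y \sum_t H x y t) + 2 * (\sum_y (y != x) * S x y)))%N.
  under eq_bigr do under eq_bigr do under eq_bigr do
    rewrite !big_split /= -!big_distrr /= !sum_delta.
  under eq_bigr do under eq_bigr do rewrite !big_split /= !sum_delta.
  have E1 : (\sum_x \sum_y \sum_t H y x t = \sum_x \sum_y \sum_t H x y t)%N by rewrite exchange_big.
  under eq_bigr do rewrite !big_split /=.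
  rewrite !big_split /= E1 -!big_split /=; apply: eq_bigr => x _; lia.
have -> : (#|V| * (8 * k ^ 2) = \sum_(x : V) 8 * k ^ 2)%N by rewrite sum_nat_const.
apply: leq_sum => x _.
(* [4 (2k^2 - (2k + 2)) + 2 * 2 (2k + 2) = 8 k^2]. *)
by have := Hx x; have := Sx x; lia.
Qed.

(** * Perturbation to general position *)

Section Perturb.
Variables (R : realFieldType) (V : finType).
Local Notation pt := (R * R * R)%type.

Definition det2 (u v : pt) : R := u.1.1 * v.1.2 - u.1.2 * v.1.1.

(* Vanishes when the planes spanned by (a, b), (c, d) and (e, f) share a line,
   so its non-vanishing excludes triple crossing points. *)
Definition plane_det (a b c d e f : pt) : R :=
  det3 (vprod a b) (vprod c d) (vprod e f).

Lemma plane_det_swap1 a b c d e f : plane_det c d a b e f = - plane_det a b c d e f.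
Proof. exact: det3C12. Qed.
Lemma plane_det_swap2 a b c d e f : plane_det a b e f c d = - plane_det a b c d e f.
Proof. exact: det3C23. Qed.

Lemma plane_detC56 a b c d e f : plane_det a b c d f e = - plane_det a b c d e f.
Proof. by rewrite /plane_det /det3 /dot /vprod /=; ring. Qed.

Lemma plane_detE a b c d e f :
  plane_det a b c d e f = dot (vprod (vprod (vprod a b) (vprod c d)) e) f.
Proof. by rewrite /plane_det /det3 /dot /vprod /=; ring. Qed.

(** The vector [d] is a witness: the planes of [(c, d)] and [(e, d)] meet in the line of [d], which
    does not lie in the plane of [(a, b)]. *)
Lemma plane_normal_neq0 (a b c d e : pt) : det3 a b d != 0 -> det3 c d e != 0 ->
  vprod (vprod (vprod a b) (vprod c d)) e != 0.
Proof.
move=> h1 h2; apply/eqP => h0.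
have : dot (vprod (vprod (vprod a b) (vprod c d)) e) d = - (det3 a b d * det3 c d e).
  by rewrite /det3 /dot /vprod /=; ring.
rewrite h0 /dot /= !mul0r !addr0 => /esym/eqP.
by rewrite oppr_eq0 mulf_eq0 (negbTE h1) (negbTE h2).
Qed.

(** The first two conditions keep vertices and arcs off the third axis, where the projection to the
    plane degenerates. The predicate [s] allows an induction over the vertices already moved. *)
Definition strongly_generic (s : pred V) (P : V -> pt) :=
  [/\ forall x, s x -> (P x).1.1 != 0,
      forall x y, s x -> s y -> x != y -> det2 (P x) (P y) != 0,
      forall x y z, s x -> s y -> s z -> x != y -> y != z -> x != z ->
        det3 (P x) (P y) (P z) != 0
    & forall a b c d e f, all s [:: a; b; c; d; e; f] -> uniq [:: a; b; c; d; e; f] ->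
        plane_det (P a) (P b) (P c) (P d) (P e) (P f) != 0].

Lemma small_affine (a b : R) : b != 0 -> small (fun e => a + e * b != 0).
Proof.
move=> b0; have [->|a0] := eqVneq a 0.
  by exists 1 => // e /andP[e0 _]; rewrite add0r mulf_neq0 // gt_eqF.
apply: small_sub (small_sg b 0 0 a0) => e _ h.
by rewrite -sgr_eq0; move: h; rewrite mulr0 addr0 mulr0 addr0 => ->; rewrite sgr_eq0.
Qed.

(** The vertices are moved one at a time. Every condition is linear in the vertex being moved, so a
    direction off finitely many planes, spanned by vertices treated before, achieves all of them,
    and a short step preserves the signs of all nonzero determinants. *)
Lemma perturb (P : V -> pt) : exists P' : V -> pt,
  (forall x y z, det3 (P x) (P y) (P z) != 0 ->
     Num.sg (det3 (P' x) (P' y) (P' z)) = Num.sg (det3 (P x) (P y) (P z))) /\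
  strongly_generic predT P'.
Proof.
suff: forall s : seq V, uniq s -> exists P' : V -> pt,
  (forall x y z, det3 (P x) (P y) (P z) != 0 ->
     Num.sg (det3 (P' x) (P' y) (P' z)) = Num.sg (det3 (P x) (P y) (P z))) /\
  strongly_generic (mem s) P'.
  move=> /(_ (enum V) (enum_uniq V)) [P' [h [h1 h2 h3 h4]]]; exists P'; split => //.
  have m x : mem (enum V) x by rewrite /= mem_enum.
  by split=> *; [apply: h1|apply: h2|apply: h3|apply: h4] => //=; rewrite !mem_enum.
elim=> [|v s IH] /=; first by move=> _; exists P; split=> //; split.
move=> /andP[vs us]; have [P1 [sg1 [g1 g2 g3 g4]]] := IH us.
(* The normals of the planes to avoid, in the order of the four clauses of [strongly_generic]. *)
pose N := [:: (1, 0, 0)] ++ [seq (- (P1 y).1.2, (P1 y).1.1, 0) | y <- s]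
  ++ [seq vprod (P1 p.1) (P1 p.2) | p <- [seq p <- enum {: V * V} |
        [&& p.1 \in s, p.2 \in s & p.1 != p.2]]]
  ++ [seq vprod (vprod (vprod (P1 p.1.1.1.1) (P1 p.1.1.1.2))
                    (vprod (P1 p.1.1.2) (P1 p.1.2))) (P1 p.2)
      | p <- [seq p <- enum {: V * V * V * V * V} |
        all (mem s) [:: p.1.1.1.1; p.1.1.1.2; p.1.1.2; p.1.2; p.2] &&
        uniq [:: p.1.1.1.1; p.1.1.1.2; p.1.1.2; p.1.2; p.2]]].
have N0 : {in N, forall n, n != 0}.
  move=> n; rewrite !mem_cat inE => /or4P[/eqP ->|/mapP[y ys ->]|/mapP[p]|/mapP[p]].
  - by apply/eqP => -[/eqP]; rewrite oner_eq0.
  - by apply/eqP => -[_ /eqP]; rewrite (negbTE (g1 _ ys)).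
  - rewrite mem_filter => /andP[/and3P[p1 p2 p12] _] ->.
    apply/eqP => -[_ _ /eqP]; exact/negP/g2.
  - rewrite mem_filter => /andP[/andP[ps pu] _] ->.
    move: ps pu => /=; rewrite !inE !negb_or => /and5P[pa pb pc pd]; rewrite andbT => pe.
    case/and5P=> /and4P[ab ac ad ae] /and3P[bc bd be] /andP[cd ce] de _.
    by apply: plane_normal_neq0; apply: g3.
have [u hu] := avoid N0.
pose move x : pt := if x == v then u else 0.
have [e e0 [hN hs]] := small_ex (small_and
  (small_all_seq (fun n (nN : n \in N) => small_affine (dot n (P1 v)) (hu n nN)))
  (small_all (fun x => small_all (fun y => small_all (fun z =>
    small_imp (A := det3 (P1 x) (P1 y) (P1 z) != 0) (fun h =>
      small_sg (det3 (move x) (P1 y) (P1 z) + det3 (P1 x) (move y) (P1 z) +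
                det3 (P1 x) (P1 y) (move z))
       (det3 (move x) (move y) (P1 z) + det3 (move x) (P1 y) (move z) +
        det3 (P1 x) (move y) (move z))
       (det3 (move x) (move y) (move z)) h)))))).
pose P2 x := translate (P1 x) e (move x).
have P2v : P2 v = translate (P1 v) e u by rewrite /P2 /move eqxx.
have P2s x : x != v -> P2 x = P1 x.
  by move=> xv; rewrite /P2 /move (negbTE xv) /translate /= !mulr0 !addr0; case: (P1 x) => [[]].
have sv x : x \in s -> x != v by apply: contraTneq => ->.
have dN n : n \in N -> dot n (P2 v) != 0.
  move=> nN; have := hN n nN; rewrite P2v; congr (_ != 0).
  by rewrite /dot /translate /=; ring.
exists P2; split.
  move=> x y z h; rewrite -sg1 //; rewrite /P2 det3_shift; apply: hs.
  by rewrite -sgr_eq0 sg1 // sgr_eq0.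
have G1 x : x \in v :: s -> (P2 x).1.1 != 0.
  rewrite inE => /predU1P[->|xs]; last by rewrite P2s ?g1 ?sv.
  have /dN : (1, 0, 0) \in N by rewrite !mem_cat inE eqxx.
  by rewrite /dot /= !mul0r !addr0 mul1r.
have D2 y : y \in s -> det2 (P1 y) (P2 v) != 0.
  move=> ys; have /dN : (- (P1 y).1.2, (P1 y).1.1, 0) \in N.
    by rewrite !mem_cat; apply/or4P/Or42; apply/mapP; exists y.
  by congr (_ != 0); rewrite /dot /det2 /=; ring.
have det2C (a b : pt) : det2 b a = - det2 a b by rewrite /det2; ring.
have D3 y z : y \in s -> z \in s -> y != z -> det3 (P1 y) (P1 z) (P2 v) != 0.
  move=> ys zs yz; apply: dN.
  rewrite !mem_cat; apply/or4P/Or43; apply/mapP; exists (y, z) => //.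
  by rewrite mem_filter /= ys zs yz mem_enum.
have D6 a b c d f : all (mem s) [:: a; b; c; d; f] -> uniq [:: a; b; c; d; f] ->
    plane_det (P1 a) (P1 b) (P1 c) (P1 d) (P1 f) (P2 v) != 0.
  move=> h1 h2; rewrite plane_detE; apply: dN.
  rewrite !mem_cat; apply/or4P/Or44; apply/mapP; exists (a, b, c, d, f) => //.
  by rewrite mem_filter h1 h2 mem_enum.
split.
- exact: G1.
- move=> x y; rewrite /= !inE => /predU1P[->|xs] /predU1P[->|ys] xy.
  + by rewrite eqxx in xy.
  + by rewrite det2C oppr_eq0 (P2s y) ?sv ?D2.
  + by rewrite (P2s x) ?sv ?D2.
  + by rewrite !P2s ?sv ?g2.
- move=> x y z; rewrite /= !inE => xs ys zs xy yz xz.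
  have [xv|xv] := eqVneq x v.
    subst x; rewrite eq_sym in xy; rewrite eq_sym in xz.
    move: ys zs; rewrite (negbTE xy) (negbTE xz) /= => ys zs.
    by rewrite -det3_rot !(P2s y, P2s z) // D3.
  move: xs; rewrite (negbTE xv) /= => xs.
  have [yv|yv] := eqVneq y v.
    subst y; rewrite eq_sym in yz; move: zs; rewrite (negbTE yz) /= => zs.
    by rewrite det3C23 oppr_eq0 !(P2s x, P2s z) // D3.
  move: ys; rewrite (negbTE yv) /= => ys.
  have [zv|zv] := eqVneq z v; first by subst z; rewrite !(P2s x, P2s y) // D3.
  move: zs; rewrite (negbTE zv) /= => zs.
  by rewrite !P2s // g3.
- have step a b c d f g : all (mem (v :: s)) [:: a; b; c; d; f; g] -> uniq [:: a; b; c; d; f; g] ->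
    g = v -> plane_det (P2 a) (P2 b) (P2 c) (P2 d) (P2 f) (P2 g) != 0.
    move=> h1 h2 gv; subst g.
    have : all (mem s) [:: a; b; c; d; f] /\ uniq [:: a; b; c; d; f].
      move: (h2); rewrite (_ : [:: a; b; c; d; f; v] = rcons [:: a; b; c; d; f] v) //.
      rewrite rcons_uniq => /andP[vn un].
      split=> //; apply/allP => x xs; have : x \in v :: s.
        have /allP := h1; apply.
        rewrite (_ : [:: a; b; c; d; f; v] = rcons [:: a; b; c; d; f] v) //.
        by rewrite mem_rcons inE xs orbT.
      by rewrite inE => /predU1P[xv|//]; rewrite -xv xs in vn.
    move=> [k1 k2]; have /and5P[ka kb kc kd /andP[kf _]] := k1.
    rewrite (P2s a) ?sv // (P2s b) ?sv // (P2s c) ?sv // (P2s d) ?sv // (P2s f) ?sv //.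
    exact: D6.
  move=> a b c d f g h1 h2.
  (* The moved vertex may stand in any of the six places; the antisymmetries of [plane_det] bring it
     to the last one. *)
  have perm6 t : perm_eq t [:: a; b; c; d; f; g] -> all (mem (v :: s)) t /\ uniq t.
    by move=> pt; rewrite (perm_all _ pt) (perm_uniq pt).
  have [gv|gv] := eqVneq g v; first exact: step.
  have [fv|fv] := eqVneq f v.
    have [|k1 k2] := perm6 [:: a; b; c; d; g; f]; first by apply/permP => p /=; ring.
    by rewrite plane_detC56 oppr_eq0; apply: step.
  have [dv|dv] := eqVneq d v.
    have [|k1 k2] := perm6 [:: a; b; f; g; c; d]; first by apply/permP => p /=; ring.
    by rewrite plane_det_swap2 oppr_eq0; apply: step.
  have [cv|cv] := eqVneq c v.
    have [|k1 k2] := perm6 [:: a; b; f; g; d; c]; first by apply/permP => p /=; ring.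
    by rewrite plane_det_swap2 oppr_eq0 plane_detC56 oppr_eq0; apply: step.
  have [bv|bv] := eqVneq b v.
    have [|k1 k2] := perm6 [:: c; d; f; g; a; b]; first by apply/permP => p /=; ring.
    by rewrite plane_det_swap1 oppr_eq0 plane_det_swap2 oppr_eq0; apply: step.
  have [av|av] := eqVneq a v.
    have [|k1 k2] := perm6 [:: c; d; f; g; b; a]; first by apply/permP => p /=; ring.
    rewrite plane_det_swap1 oppr_eq0 plane_det_swap2 oppr_eq0 plane_detC56 oppr_eq0.
    exact: step.
  rewrite !P2s //; apply: g4 => //.
  move: h1; rewrite /= !inE.
  by rewrite (negbTE av) (negbTE bv) (negbTE cv) (negbTE dv) (negbTE fv) (negbTE gv).
Qed.
End Perturb.

(** Each determinant that decides a crossing contains both ends of an edge, so degenerate triples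
    without an edge are harmless. This is why the base drawing is only checked on triples with an
    edge. *)
Lemma ncross_perturb (R : realFieldType) (V : finType) (P P' : V -> R * R * R)
    (w : V -> V -> nat) :
  (forall x y z, det3 (P x) (P y) (P z) != 0 ->
     Num.sg (det3 (P' x) (P' y) (P' z)) = Num.sg (det3 (P x) (P y) (P z))) ->
  (forall x y z, w x y != 0%N -> z != x -> z != y -> det3 (P x) (P y) (P z) != 0) ->
  ncross P' w = ncross P w.
Proof.
move=> sgP h.
apply: eq_bigr => x _; apply: eq_bigr => y _; apply: eq_bigr => z _; apply: eq_bigr => t _.
have [->|wxy] := eqVneq (w x y) 0%N; first by rewrite !mul0n.
have [->|wzt] := eqVneq (w z t) 0%N; first by rewrite muln0 !mul0n.
congr (_ * nat_of_bool _)%N.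
have [->|zx] := eqVneq z x; first by rewrite !crossb_eq13.
have [->|zy] := eqVneq z y; first by rewrite !crossb_eq23.
have [->|tx] := eqVneq t x; first by rewrite !crossb_eq14.
have [->|ty] := eqVneq t y; first by rewrite !crossb_eq24.
have xz : x != z by rewrite eq_sym.
have xt : x != t by rewrite eq_sym.
have yz : y != z by rewrite eq_sym.
have yt : y != t by rewrite eq_sym.
by apply: crossb_sg; apply: sgP; apply: h.
Qed.

(** * Weighted quotients of the augmented cubes *)

Local Close Scope ring_scope.
Local Open Scope nat_scope.

Fixpoint bits (k : nat) : finType := if k is k'.+1 then (bits k' * bool)%type else unit.

Lemma card_bits k : #|bits k| = 2 ^ k.
Proof. by elim: k => [|k IH] /=; rewrite ?card_unit // card_prod card_bool IH expnS mulnC. Qed.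

(* The letters of a word are listed outwards from the gap, on both sides of which a
   class of edges of weight 2 flips the nearest letter: [I] on the side that grows,
   [J] on the other one. When a letter is inserted next to the gap, one of the two
   units of [I] has to flip it as well; in the last step, which closes the gap, this
   also holds for [J], and the new letter gets weight 1. *)
Section Ext.
Variables (V : finType) (w : V -> V -> nat) (I J : V -> V -> bool).

Definition ext_weight (p q : V * bool) : nat :=
  if p.1 == q.1 then (if p.2 == q.2 then 0 else 2)
  else if p.2 == q.2 then w p.1 q.1 - I p.1 q.1 else I p.1 q.1.
Definition ext_inner (p q : V * bool) := (p.1 == q.1) && (p.2 != q.2).
Definition ext_outer (p q : V * bool) := (p.2 == q.2) && J p.1 q.1.
Definition ext_last (p q : V * bool) : nat :=
  if p.1 == q.1 then (p.2 != q.2 : nat)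
  else if p.2 == q.2 then w p.1 q.1 - I p.1 q.1 - J p.1 q.1
  else I p.1 q.1 + J p.1 q.1.

End Ext.

Record regular_weight (V : finType) (k : nat) (w : V -> V -> nat) (I J : V -> V -> bool) : Prop :=
  RegularWeight {
    rw_sym : forall x y, w x y = w y x;
    rw_refl : forall x, w x x = 0;
    rw_le2 : forall x y, w x y <= 2;
    rw_sum : forall x, \sum_y w x y = k.*2;
    rw_sqr : forall x, \sum_y w x y ^ 2 = k.*2 + 4;
    rw_Isym : forall x y, I x y = I y x;
    rw_Jsym : forall x y, J x y = J y x;
    rw_I1 : forall x, \sum_y I x y = 1;
    rw_J1 : forall x, \sum_y J x y = 1;
    rw_wI : forall x y, I x y -> w x y = 2;
    rw_wJ : forall x y, J x y -> w x y = 2;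
    rw_IJ : forall x y, ~~ (I x y && J x y) }.

Section Extension.
Variables (V : finType) (k : nat) (w : V -> V -> nat) (I J : V -> V -> bool).
Hypothesis H : regular_weight k w I J.

Let Ixx x : I x x = false.
Proof. by apply/negP => /(rw_wI H); rewrite (rw_refl H). Qed.
Let Jxx x : J x x = false.
Proof. by apply/negP => /(rw_wJ H); rewrite (rw_refl H). Qed.

(** The weight 2 of [I] splits into 1 and 1 and the new letter receives weight 2: the sum grows by 2
    and the sum of squares by [4 - 2]. *)
Lemma ext_regular : regular_weight k.+1 (ext_weight w I) (@ext_inner V) (ext_outer J).
Proof.
have split_sum (F : V * bool -> nat) x i :
    \sum_q F q = F (x, i) + F (x, ~~ i) + \sum_(y | y != x) (F (y, i) + F (y, ~~ i)).
  have Fi y : \sum_j F (y, j) = F (y, i) + F (y, ~~ i).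
    by rewrite big_bool /=; case: i => /=; [|exact: addnC].
  by rewrite sum_pair (bigD1 x) //= Fi; congr (_ + _); apply: eq_bigr => y _.
have bool_ne (i : bool) : (i == ~~ i) = false by case: i.
split.
- by move=> [x i] [y j]; rewrite /ext_weight /= eq_sym [i == j]eq_sym (rw_sym H) (rw_Isym H).
- by move=> [x i]; rewrite /ext_weight /= !eqxx.
- move=> [x i] [y j]; rewrite /ext_weight /=; do 2![case: ifP => //=] => _ _.
    exact: leq_trans (leq_subr _ _) (rw_le2 H _ _).
  by case: (I x y).
- move=> [x i]; rewrite (split_sum _ x i) /ext_weight /= !eqxx bool_ne.
  rewrite (eq_bigr (w x)); last first.
    move=> y yx; rewrite eq_sym (negbTE yx) subnK //.
    by case: (boolP (I x y)) => // /(rw_wI H) ->.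
  by have := rw_sum H x; rewrite (bigD1 x) //= (rw_refl H); lia.
- move=> [x i]; rewrite (split_sum _ x i) /ext_weight /= !eqxx bool_ne.
  have E : \sum_(y | y != x) w x y ^ 2 = k.*2 + 4.
    by rewrite -(rw_sqr H x) [RHS](bigD1 x) //= (rw_refl H).
  have E2 : \sum_(y | y != x) (2 * I x y) = 2.
    by rewrite -big_distrr /=; have := rw_I1 H x; rewrite (bigD1 x) //= Ixx; lia.
  have : \sum_(y | y != x) ((if x == y then 0 else w x y - I x y) ^ 2 +
      (if x == y then 2 else (I x y : nat)) ^ 2) + \sum_(y | y != x) (2 * I x y) =
      \sum_(y | y != x) w x y ^ 2.
    rewrite -big_split /=; apply: eq_bigr => y yx.
    rewrite eq_sym (negbTE yx); case: (boolP (I x y)) => [/(rw_wI H) ->//|_].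
    by rewrite subn0 !addn0.
  by rewrite E E2; lia.
- by move=> [x i] [y j]; rewrite /ext_inner /= eq_sym [i == j]eq_sym.
- by move=> [x i] [y j]; rewrite /ext_outer /= eq_sym (rw_Jsym H).
- move=> [x i]; rewrite (split_sum _ x i) /ext_inner /= !eqxx bool_ne /= big1 // => y yx.
  by rewrite eq_sym (negbTE yx).
- move=> [x i]; rewrite (split_sum _ x i) /ext_outer /= !eqxx bool_ne /= Jxx.
  have := rw_J1 H x; rewrite (bigD1 x) //= Jxx /= => <-; congr (_ + _).
  by apply: eq_bigr => y _; rewrite addn0.
- by move=> [x i] [y j]; rewrite /ext_inner /ext_weight /= => /andP[-> /negbTE ->].
- move=> [x i] [y j]; rewrite /ext_outer /ext_weight /= => /andP[-> Jxy].
  have -> : (x == y) = false by apply: contraTF Jxy => /eqP ->; rewrite Jxx.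
  by have := rw_IJ H x y; rewrite Jxy andbT => /negbTE ->; rewrite subn0 (rw_wJ H).
- move=> [x i] [y j]; rewrite /ext_inner /ext_outer /=; case: (eqVneq x y) => //= ->.
  by rewrite Jxx !andbF.
Qed.

Lemma ext_weight_fiber x y i : x != y ->
  ext_weight w I (x, i) (y, false) + ext_weight w I (x, i) (y, true) = w x y.
Proof.
move=> xy; rewrite /ext_weight /= (negbTE xy).
have le : I x y <= w x y by case: (boolP (I x y)) => // /(rw_wI H) ->.
by case: i => /=; rewrite ?subnK // addnC subnK.
Qed.

Lemma ext_last_fiber x y i : x != y ->
  ext_last w I J (x, i) (y, false) + ext_last w I J (x, i) (y, true) = w x y.
Proof.
move=> xy; rewrite /ext_last /= (negbTE xy) -subnDA.
have le : I x y + J x y <= w x y.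
  have := rw_IJ H x y; case: (boolP (I x y)) => [/(rw_wI H) ->|_]; first by case: (J x y).
  by case: (boolP (J x y)) => // /(rw_wJ H) ->.
by case: i => /=; rewrite ?subnK // addnC subnK.
Qed.

Lemma ext_weight_sqr x i :
  \sum_(y | y != x) \sum_j ext_weight w I (x, i) (y, j) ^ 2 <= k.*2 + 2.
Proof.
have := rw_sqr ext_regular (x, i); rewrite sum_pair (bigD1 x) //= big_bool /=.
have -> : ext_weight w I (x, i) (x, true) ^ 2 + ext_weight w I (x, i) (x, false) ^ 2 = 4.
  by rewrite /ext_weight /= eqxx; case: i.
by lia.
Qed.

(** Compared with [ext_weight], a weight 2 of [J] is now also split into 1 and 1, which can only
    lower the squares. *)
Lemma ext_last_sqr x i :
  \sum_(y | y != x) \sum_j ext_last w I J (x, i) (y, j) ^ 2 <= k.*2 + 2.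
Proof.
apply: leq_trans (ext_weight_sqr x i); apply: leq_sum => y yx.
rewrite !big_bool /= /ext_last /ext_weight /= eq_sym (negbTE yx).
have := rw_IJ H x y.
case: (boolP (I x y)) => [/(rw_wI H) ->|_]; first by case: (J x y) => // _; case: i.
case: (boolP (J x y)) => [/(rw_wJ H) -> _|_ _]; first by case: i.
by rewrite !subn0.
Qed.

End Extension.

(** Without letters on the growing side the class [I] is empty, so that [regular_weight] can hold
    only from [m = 1] on. *)
Fixpoint inner m : bits (m + 3) -> bits (m + 3) -> bool :=
  if m is m'.+1 then ext_inner (V := bits (m' + 3)) else fun _ _ => false.

Fixpoint outer m : bits (m + 3) -> bits (m + 3) -> bool :=
  if m is m'.+1 then ext_outer (outer (m := m')) else ext_inner (V := bits 2).

(** The side that does not grow: its three letters, of which [p.2] is next to the gap, and the two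
    pairs of neighbours. *)
Definition weight3 (p q : bits 3) : nat :=
  match p.1.1.2 != q.1.1.2, p.1.2 != q.1.2, p.2 != q.2 with
  | false, false, true => 2
  | true, false, false | false, true, false
  | true, true, false | false, true, true => 1
  | _, _, _ => 0
  end.

Fixpoint weight m : bits (m + 3) -> bits (m + 3) -> nat :=
  if m is m'.+1 then ext_weight (weight (m := m')) (inner (m := m')) else weight3.

Definition weight_last m : bits (m.+1 + 3) -> bits (m.+1 + 3) -> nat :=
  ext_last (weight (m := m)) (inner (m := m)) (outer (m := m)).

Fixpoint bits_seq k : seq (bits k) :=
  if k is k1.+1 then [seq (p, false) | p <- bits_seq k1] ++ [seq (p, true) | p <- bits_seq k1]
  else [:: tt].

Lemma mem_bits_seq k (p : bits k) : p \in bits_seq k.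
Proof.
elim: k p => [[]//|k IH [p b]] /=; rewrite mem_cat; apply/orP.
by case: b; [right|left]; apply/mapP; exists p.
Qed.

Lemma sum_bits_seq k (F : bits k -> nat) : \sum_p F p = \sum_(p <- bits_seq k) F p.
Proof.
elim: k F => [|k IH] F /=; first by rewrite big_seq1 (big_pred1 tt) //; case.
rewrite big_cat !big_map /= -!IH sum_pair -big_split; apply: eq_bigr => p _.
by rewrite big_bool /= addnC.
Qed.

Fixpoint above T (s : seq T) : seq (T * T) :=
  if s is x :: s1 then [seq (x, y) | y <- s1] ++ above s1 else [::].

Lemma sum_above T (s : seq T) (F : T -> T -> nat) :
  (forall x y, F x y = F y x) -> (forall x, F x x = 0) ->
  \sum_(x <- s) \sum_(y <- s) F x y = 2 * \sum_(p <- above s) F p.1 p.2.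
Proof.
move=> FC F0; elim: s => [|x s IH] /=; first by rewrite !big_nil.
rewrite big_cat big_map /= mulnDr -IH big_cons big_cons F0 add0n.
have -> : \sum_(y <- s) \sum_(z <- x :: s) F y z =
    \sum_(y <- s) F x y + \sum_(y <- s) \sum_(z <- s) F y z.
  by rewrite -big_split; apply: eq_bigr => y _; rewrite big_cons FC.
by rewrite mul2n -addnn addnA.
Qed.

Lemma base_regular : regular_weight 4 (weight (m := 1)) (inner (m := 1)) (outer (m := 1)).
Proof.
have all1 (Q : bits 4 -> bool) : all Q (bits_seq 4) -> forall x, Q x.
  by move=> /allP h x; apply: h; apply: mem_bits_seq.
have all2 (Q : bits 4 -> bits 4 -> bool) :
    all (fun x => all (Q x) (bits_seq 4)) (bits_seq 4) -> forall x y, Q x y.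
  by move=> h x y; move: (all1 _ h x) y; apply: all1.
split.
- by move=> x y; apply/eqP; move: x y; apply: all2.
- by move=> x; apply/eqP; move: x; apply: all1.
- by apply: all2.
- by move=> x; rewrite sum_bits_seq unlock; apply/eqP; move: x; apply: all1.
- by move=> x; rewrite sum_bits_seq unlock; apply/eqP; move: x; apply: all1.
- by move=> x y; apply/eqP; move: x y; apply: all2.
- by move=> x y; apply/eqP; move: x y; apply: all2.
- by move=> x; rewrite sum_bits_seq unlock; apply/eqP; move: x; apply: all1.
- by move=> x; rewrite sum_bits_seq unlock; apply/eqP; move: x; apply: all1.
- move=> x y h; apply/eqP; apply: (implyP (_ : inner x y ==> _)) h; move: x y; exact: all2.
- move=> x y h; apply/eqP; apply: (implyP (_ : outer x y ==> _)) h; move: x y; exact: all2.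
- by apply: all2.
Qed.

(** * The base drawing *)

Local Delimit Scope Z_scope with BZ.

Inductive tree (T : Type) := Leaf of T | Node of tree T & tree T.

Fixpoint tree_get T (x0 : T) (t : tree T) (w : seq bool) : T :=
  match t, w with
  | Leaf x, _ => x
  | Node l r, b :: w1 => tree_get x0 (if b then r else l) w1
  | _, _ => x0
  end.

Fixpoint tree_map T T1 (f : T -> T1) (t : tree T) : tree T1 :=
  match t with Leaf x => Leaf (f x) | Node l r => Node (tree_map f l) (tree_map f r) end.

Lemma tree_get_map T T1 (f : T -> T1) x0 t w :
  tree_get (f x0) (tree_map f t) w = f (tree_get x0 t w).
Proof. by elim: t w => [x|l IHl r IHr] [|[] w] /=. Qed.

Fixpoint word k : bits k -> seq bool :=
  if k is k1.+1 then fun p => p.2 :: word p.1 else fun _ => [::].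

Fixpoint words k : seq (seq bool) :=
  if k is k1.+1 then [seq false :: w | w <- words k1] ++ [seq true :: w | w <- words k1]
  else [:: [::]].

Lemma mem_words k (p : bits k) : word p \in words k.
Proof.
elim: k p => [[]//|k IH [p b]] /=; rewrite mem_cat; apply/orP.
by case: b; [right|left]; apply/mapP; exists (word p).
Qed.

Lemma word_inj k : injective (@word k).
Proof. by elim: k => [[] []//|k IH [p b] [q c]] /= [-> /IH ->]. Qed.

Lemma sum_words k (F : seq bool -> nat) : \sum_(p : bits k) F (word p) = \sum_(w <- words k) F w.
Proof.
elim: k F => [|k IH] F /=; first by rewrite big_seq1 (big_pred1 tt) //; case.
rewrite big_cat !big_map /= -!(IH (fun w => F (_ :: w))) sum_pair -big_split.
by apply: eq_bigr => p _; rewrite big_bool /= addnC.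
Qed.

(* Counterparts of [weight], [inner] on plain bit lists, on which kernel
   computation does not unfold the finite type structures. *)
Fixpoint eqw (x y : seq bool) : bool :=
  match x, y with
  | [::], [::] => true
  | b :: x1, c :: y1 =>
    if b then (if c then eqw x1 y1 else false) else (if c then false else eqw x1 y1)
  | _, _ => false
  end.

Definition innerw m (x y : seq bool) : bool :=
  match m, x, y with
  | _.+1, b :: x1, c :: y1 => if eqw x1 y1 then addb b c else false
  | _, _, _ => false
  end.

Fixpoint weightw m (x y : seq bool) : nat :=
  match m, x, y with
  | m1.+1, b :: x1, c :: y1 =>
    if eqw x1 y1 then (if addb b c then 2 else 0)
    else if addb b c then (innerw m1 x1 y1 : nat) else weightw m1 x1 y1 - innerw m1 x1 y1
  | 0, [:: b2; b1; b0], [:: c2; c1; c0] =>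
    match addb b0 c0, addb b1 c1, addb b2 c2 with
    | false, false, true => 2
    | true, false, false | false, true, false
    | true, true, false | false, true, true => 1
    | _, _, _ => 0
    end
  | _, _, _ => 0
  end.

Lemma eqwE x y : eqw x y = (x == y).
Proof. by elim: x y => [|b x IH] [|c y] //=; rewrite IH eqseq_cons; case: b; case: c. Qed.

Lemma eqw_word k (p q : bits k) : eqw (word p) (word q) = (p == q).
Proof. by rewrite eqwE (eqtype.inj_eq (@word_inj k)). Qed.

Lemma innerwE m (p q : bits (m + 3)) : innerw m (word p) (word q) = inner p q.
Proof.
case: m p q => [|m] [p b] [q c] //=; rewrite /ext_inner /= eqw_word.
by case: (p == q) => //; case: b; case: c.
Qed.

Lemma weightwE m (p q : bits (m + 3)) : weightw m (word p) (word q) = weight p q.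
Proof.
elim: m p q => [|m IH].
  move=> [[[[] b0] b1] b2] [[[[] c0] c1] c2]; rewrite /= /weight3 /=.
  by case: b0; case: c0; case: b1; case: c1; case: b2; case: c2.
move=> [p b] [q c]; rewrite /= /ext_weight /= eqw_word innerwE IH.
by case: (p == q); case: b; case: c.
Qed.

Definition zpoint : Type := (Z * Z * Z)%type.

Definition zvprod (u v : zpoint) : zpoint :=
  (u.1.2 * v.2 - u.2 * v.1.2, u.2 * v.1.1 - u.1.1 * v.2, u.1.1 * v.1.2 - u.1.2 * v.1.1)%BZ.
Definition zdot (u v : zpoint) : Z := (u.1.1 * v.1.1 + u.1.2 * v.1.2 + u.2 * v.2)%BZ.
Definition zpoint0 : zpoint := (0, 0, 0)%BZ.

(* A drawing of the weighted quotient of dimension 7, found by simulated annealing;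
   the path to a leaf spells its [word]. *)
Definition base_points : tree zpoint := (
Node (Node (Node (Node (Node (Node (Node (Leaf (-13, 146, 136)) (Leaf (27, 150, 130)))
(Node (Leaf (-137, 117, 88)) (Leaf (175, 90, 36))))
(Node (Node (Leaf (-25, 145, 136)) (Leaf (111, 136, 96)))
(Node (Leaf (-117, 109, 120)) (Leaf (167, 98, 49)))))
(Node (Node (Node (Leaf (32, 79, -181)) (Leaf (63, 67, -178)))
(Node (Leaf (-190, 20, -59)) (Leaf (163, -97, -63))))
(Node (Node (Leaf (32, 83, -179)) (Leaf (108, 55, -159)))
(Node (Leaf (-157, -30, -120)) (Leaf (181, -47, -70))))))
(Node (Node (Node (Node (Leaf (19, 192, 52)) (Leaf (27, 191, 53)))
(Node (Leaf (-88, 179, 7)) (Leaf (177, 92, 5))))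
(Node (Node (Leaf (-24, 194, 43)) (Leaf (125, 149, 48)))
(Node (Leaf (-49, 190, -37)) (Leaf (160, 119, -14)))))
(Node (Node (Node (Leaf (62, 141, -128)) (Leaf (67, 138, -128)))
(Node (Leaf (-148, 130, -35)) (Leaf (190, 60, -14))))
(Node (Node (Leaf (2, 160, -120)) (Leaf (111, 114, -121)))
(Node (Leaf (-80, 174, -57)) (Leaf (188, 66, -12)))))))
(Node (Node (Node (Node (Node (Leaf (-46, -35, 192)) (Leaf (-2, -33, 197)))
(Node (Leaf (-137, -43, 140)) (Leaf (162, -21, 116))))
(Node (Node (Leaf (-51, -18, 193)) (Leaf (10, 1, 200)))
(Node (Leaf (-91, -2, 178)) (Leaf (131, 59, 139)))))
(Node (Node (Node (Leaf (-58, -182, -58)) (Leaf (-37, -188, -59)))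
(Node (Leaf (-189, -62, -16)) (Leaf (36, -195, -26))))
(Node (Node (Leaf (-62, -175, -75)) (Leaf (-19, -189, -63)))
(Node (Leaf (-177, -48, -81)) (Leaf (109, -157, -59))))))
(Node (Node (Node (Node (Leaf (-29, -107, 167)) (Leaf (-28, -107, 167)))
(Node (Leaf (-137, -55, 135)) (Leaf (65, -161, 99))))
(Node (Node (Leaf (-84, -74, 166)) (Leaf (5, -125, 156)))
(Node (Leaf (-141, -78, 119)) (Leaf (75, -180, 45)))))
(Node (Node (Node (Leaf (-62, -190, -15)) (Leaf (-57, -191, -14)))
(Node (Leaf (-165, -102, 50)) (Leaf (54, -192, 17))))
(Node (Node (Leaf (-109, -168, -3)) (Leaf (-12, -200, -6)))
(Node (Leaf (-147, -118, 68)) (Leaf (69, -185, 28))))))))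
(Node (Node (Node (Node (Node (Node (Leaf (-30, 108, 166)) (Leaf (36, 129, 149)))
(Node (Leaf (-121, 8, 159)) (Leaf (175, 78, 57))))
(Node (Node (Leaf (-49, 138, 136)) (Leaf (91, 135, 116)))
(Node (Leaf (-115, 38, 159)) (Leaf (169, 94, 53)))))
(Node (Node (Node (Leaf (40, 96, -171)) (Leaf (69, 84, -168)))
(Node (Leaf (-167, 98, -50)) (Leaf (192, -29, -47))))
(Node (Node (Leaf (11, 102, -172)) (Leaf (73, 82, -167)))
(Node (Leaf (-153, 104, -76)) (Leaf (189, -22, -62))))))
(Node (Node (Node (Node (Leaf (18, 192, 53)) (Leaf (29, 175, 92)))
(Node (Leaf (-96, 174, 22)) (Leaf (180, 86, 14))))
(Node (Node (Leaf (-33, 187, 62)) (Leaf (117, 152, 56)))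
(Node (Leaf (-72, 186, -11)) (Leaf (166, 111, -4)))))
(Node (Node (Node (Leaf (53, 127, -145)) (Leaf (69, 126, -139)))
(Node (Leaf (-161, 109, -47)) (Leaf (196, 7, -37))))
(Node (Node (Leaf (-1, 156, -125)) (Leaf (103, 117, -125)))
(Node (Leaf (-154, 118, -48)) (Leaf (196, 21, -35)))))))
(Node (Node (Node (Node (Node (Leaf (-51, -29, 191)) (Leaf (-1, -30, 198)))
(Node (Leaf (-135, -40, 142)) (Leaf (162, -20, 116))))
(Node (Node (Leaf (-57, -12, 191)) (Leaf (10, 8, 200)))
(Node (Leaf (-96, 12, 175)) (Leaf (154, 80, 99)))))
(Node (Node (Node (Leaf (-56, -174, -80)) (Leaf (-27, -182, -79)))
(Node (Leaf (-189, -58, -31)) (Leaf (27, -194, -40))))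
(Node (Node (Leaf (-62, -172, -81)) (Leaf (-25, -179, -85)))
(Node (Leaf (-179, -32, -82)) (Leaf (135, -119, -86))))))
(Node (Node (Node (Node (Leaf (-32, -72, 184)) (Leaf (-13, -57, 191)))
(Node (Leaf (-139, -49, 135)) (Leaf (61, -154, 113))))
(Node (Node (Leaf (-84, -72, 166)) (Leaf (6, -117, 162)))
(Node (Leaf (-142, -52, 131)) (Leaf (92, -169, 54)))))
(Node (Node (Node (Leaf (-61, -189, -24)) (Leaf (-50, -193, -19)))
(Node (Leaf (-185, -71, 25)) (Leaf (41, -195, -13))))
(Node (Node (Leaf (-114, -163, -20)) (Leaf (1, -200, -11)))
(Node (Leaf (-159, -67, 101)) (Leaf (78, -183, 24)))))))))%BZ.

Definition side (n p : zpoint) : comparison := Z.compare (zdot n p) 0.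

Definition crossc (s1 s2 s3 s4 : comparison) : bool :=
  match s1, s2 with
  | Lt, Gt => if s3 is Gt then (if s4 is Lt then true else false) else false
  | Gt, Lt => if s3 is Lt then (if s4 is Gt then true else false) else false
  | _, _ => false
  end.

(** The tree stores the side of every vertex with respect to the plane of the edge, so that testing
    two edges takes four look-ups and no arithmetic. *)
Definition base_edge : Type := (seq bool * seq bool * nat * tree comparison)%type.

Definition edge_data (p : seq bool * seq bool) : base_edge :=
  (p.1, p.2, weightw 4 p.1 p.2,
   tree_map (side (zvprod (tree_get zpoint0 base_points p.1)
                          (tree_get zpoint0 base_points p.2))) base_points).

Definition base_edges : seq base_edge :=
  [seq edge_data p | p <- above (words 7) & weightw 4 p.1 p.2 != 0].

Definition edge_cross (e f : base_edge) : bool :=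
  crossc (tree_get Eq e.2 f.1.1.1) (tree_get Eq e.2 f.1.1.2)
         (tree_get Eq f.2 e.1.1.1) (tree_get Eq f.2 e.1.1.2).

Definition base_count (es : seq base_edge) : nat :=
  sumn [seq sumn [seq if edge_cross e f then e.1.2 * f.1.2 else 0 | f <- es] | e <- es].

Definition base_nondegenerate (es : seq base_edge) : bool :=
  all (fun e => all (fun z =>
    if tree_get Eq e.2 z is Eq then eqw z e.1.1.1 || eqw z e.1.1.2 else true)
                    (words 7)) es.

Lemma base_nondegenerate_edges : base_nondegenerate base_edges.
Proof. by vm_compute. Qed.

(** Pairs of edges are counted in both orders, so this allows [71 * 128 = 9088] weighted crossings,
    the value at which [crossing_bound] is an equality in dimension 7. *)
Lemma base_count_edges : base_count base_edges <= 142 * 128.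
Proof. by vm_compute. Qed.

Local Open Scope ring_scope.

Section Base.
Variable R : realFieldType.
Local Notation pt := (R * R * R)%type.

Definition realz (z : Z) : R := (int_of_Z z)%:~R.

Lemma realzM a b : realz (a * b)%BZ = realz a * realz b.
Proof. by rewrite /realz -rmorphM -(rmorphM int_of_Z). Qed.
Lemma realzD a b : realz (a + b)%BZ = realz a + realz b.
Proof. by rewrite /realz -rmorphD -(rmorphD int_of_Z). Qed.
Lemma realzB a b : realz (a - b)%BZ = realz a - realz b.
Proof. by rewrite /realz -rmorphB -(rmorphB int_of_Z). Qed.

Definition realpt (p : zpoint) : pt := (realz p.1.1, realz p.1.2, realz p.2).

Lemma det3_realpt a b c : det3 (realpt a) (realpt b) (realpt c) = realz (zdot (zvprod a b) c).
Proof. by rewrite /det3 /dot /vprod /zdot /zvprod /= !(realzD, realzM, realzB). Qed.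

Definition sign3 (x : R) : comparison := if x < 0 then Lt else if 0 < x then Gt else Eq.

Lemma sign3_realz z : sign3 (realz z) = Z.compare z 0.
Proof.
rewrite /sign3 /realz ltrz0 ltr0z; case: z => [|p|p] //=.
by have := Pos2Nat.is_pos p; case: (Pos.to_nat p) => //; lia.
Qed.

Lemma crossb_sign3 (a b c d : pt) : crossb a b c d =
  crossc (sign3 (det3 a b c)) (sign3 (det3 a b d)) (sign3 (det3 c d a)) (sign3 (det3 c d b)).
Proof.
have prod (x y : R) : (x * y < 0) =
    match sign3 x, sign3 y with Lt, Gt | Gt, Lt => true | _, _ => false end.
  rewrite /sign3; case: (ltrgt0P x) => [x0|x0|->]; last by rewrite mul0r ltxx.
    by rewrite pmulr_rlt0 //; case: (ltrgt0P y).
  by rewrite nmulr_rlt0 //; case: (ltrgt0P y).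
rewrite /crossb !prod.
by case: (sign3 (det3 a b c)); case: (sign3 (det3 a b d)); case: (sign3 (det3 c d a));
  case: (sign3 (det3 c d b)).
Qed.

Definition base_config (p : bits 7) : pt := realpt (tree_get zpoint0 base_points (word p)).

Lemma edge_side (x y z : seq bool) :
  tree_get Eq (tree_map (side (zvprod (tree_get zpoint0 base_points x)
     (tree_get zpoint0 base_points y))) base_points) z =
  sign3 (det3 (realpt (tree_get zpoint0 base_points x)) (realpt (tree_get zpoint0 base_points y))
     (realpt (tree_get zpoint0 base_points z))).
Proof.
set n := zvprod _ _.
(* The default point has side [Eq], so the two look-ups agree on every path, even one that reaches
   no leaf. *)
have e0 : side n zpoint0 = Eq by rewrite /side /zdot /= !Z.mul_0_r.
by rewrite det3_realpt sign3_realz -[Eq]e0 tree_get_map.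
Qed.

Lemma edge_crossE p q : edge_cross (edge_data p) (edge_data q) =
  crossb (realpt (tree_get zpoint0 base_points p.1)) (realpt (tree_get zpoint0 base_points p.2))
    (realpt (tree_get zpoint0 base_points q.1)) (realpt (tree_get zpoint0 base_points q.2)).
Proof. by rewrite crossb_sign3 /edge_cross !edge_side. Qed.

Lemma weightw_sym m x y : weightw m x y = weightw m y x.
Proof.
have eqwC u v : eqw u v = eqw v u by rewrite !eqwE eq_sym.
have innerC k u v : innerw k u v = innerw k v u.
  by case: k u v => [|k] [|b u] [|c v] //=; rewrite eqwC addbC.
elim: m x y => [|m IH].
  move=> x y; case: x => [|x0 [|x1 [|x2 [|x3 x]]]]; case: y => [|y0 [|y1 [|y2 [|y3 y]]]] //=.
  by rewrite (addbC x0) (addbC x1) (addbC x2).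
by case=> [|b x] [|c y] //=; rewrite eqwC addbC IH innerC.
Qed.

Lemma weightw_refl m x : weightw m x x = 0%N.
Proof.
elim: m x => [|m IH]; last by case=> [|b x] //=; rewrite eqwE eqxx addbb.
by case=> [|x0 [|x1 [|x2 [|x3 x]]]] //=; rewrite !addbb.
Qed.

Arguments weightw : simpl never.

(** The factor 4 accounts for the two orientations of each of the two edges; [base_count] still
    counts both orders of the pair. *)
Lemma sum_crossings (ws : seq (seq bool)) :
  (\sum_(x <- ws) \sum_(y <- ws) \sum_(z <- ws) \sum_(t <- ws) weightw 4 x y * weightw 4 z t *
     crossb (realpt (tree_get zpoint0 base_points x)) (realpt (tree_get zpoint0 base_points y))
       (realpt (tree_get zpoint0 base_points z)) (realpt (tree_get zpoint0 base_points t)) =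
   4 * base_count [seq edge_data p | p <- above ws & weightw 4 p.1 p.2 != 0%N])%N.
Proof.
rewrite sum_above; first last.
- by move=> x; apply: big1 => z _; apply: big1 => t _; rewrite weightw_refl.
- move=> x y; apply: eq_bigr => z _; apply: eq_bigr => t _.
  by rewrite (weightw_sym _ y x) crossbCl.
rewrite -[4%N]/(2 * 2)%N -mulnA; congr (2 * _)%N.
rewrite /base_count sumnE !big_map big_filter big_distrr /= [RHS]big_mkcond /=.
apply: eq_bigr => p _; rewrite sum_above; first last.
- by move=> z; rewrite weightw_refl muln0.
- by move=> z t; rewrite (weightw_sym _ z t) crossbCr.
case: ifP => [_|/negbFE/eqP W0]; last by rewrite big1 // => q _; rewrite W0.
congr (2 * _)%N; rewrite sumnE !big_map big_filter [RHS]big_mkcond /=.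
apply: eq_bigr => q _; rewrite edge_crossE.
by case: (crossb _ _ _ _); case: eqP => [->|_] /=; rewrite ?muln0 ?muln1.
Qed.

Lemma ncross_base : (ncross base_config (weight (m := 4)) = 4 * base_count base_edges)%N.
Proof.
rewrite -sum_crossings -(@sum_words 7); apply: eq_bigr => x _.
rewrite -(@sum_words 7); apply: eq_bigr => y _.
rewrite -(@sum_words 7); apply: eq_bigr => z _.
rewrite -(@sum_words 7); apply: eq_bigr => t _.
by rewrite !(@weightwE 4).
Qed.

Lemma mem_above (T : eqType) (s : seq T) x y : x \in s -> y \in s -> x != y ->
  ((x, y) \in above s) || ((y, x) \in above s).
Proof.
elim: s => //= z s IH; rewrite !inE !mem_cat => xs ys xy.
have [xz|xz] := eqVneq x z.
  subst z; move: ys; rewrite eq_sym (negbTE xy) /= => ys.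
  by rewrite (_ : (x, y) \in _) //; apply/mapP; exists y.
have [yz|yz] := eqVneq y z.
  subst z; move: xs; rewrite (negbTE xz) /= => xs.
  by rewrite [X in _ || (X || _)](_ : _ = true) ?orbT //; apply/mapP; exists x.
move: xs ys; rewrite (negbTE xz) (negbTE yz) /= => xs ys.
by have /orP[->|->] := IH xs ys xy; rewrite !orbT.
Qed.

Lemma base_side p z : p \in above (words 7) -> weightw 4 p.1 p.2 != 0%N -> z \in words 7 ->
  z != p.1 -> z != p.2 ->
  det3 (realpt (tree_get zpoint0 base_points p.1)) (realpt (tree_get zpoint0 base_points p.2))
    (realpt (tree_get zpoint0 base_points z)) != 0.
Proof.
move=> pA pW zw z1 z2; have := base_nondegenerate_edges.
rewrite /base_nondegenerate /base_edges all_map all_filter => /allP/(_ p pA).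
move=> /implyP/(_ pW)/allP/(_ z zw); rewrite edge_side !eqwE (negbTE z1) (negbTE z2) /sign3.
by apply: contraTneq => ->; rewrite ltxx.
Qed.

Lemma base_edge_side (x y z : bits 7) : weight (m := 4) x y != 0%N -> z != x -> z != y ->
  det3 (base_config x) (base_config y) (base_config z) != 0.
Proof.
rewrite -(@weightwE 4) => w0 zx zy.
have wz (u v : bits 7) : u != v -> word u != word v by apply: contraNN => /eqP/word_inj ->.
have xy : x != y by apply: contraNneq w0 => ->; rewrite weightw_refl.
have := mem_above (mem_words x) (mem_words y) (wz _ _ xy) => /orP[h|h].
  by apply: (base_side h) => //; [exact: mem_words|exact: wz|exact: wz].
rewrite det3C12 oppr_eq0; apply: (base_side h) => //; first by rewrite weightw_sym.
- exact: mem_words.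
- exact: wz.
- exact: wz.
Qed.

Lemma base_drawing : exists2 P : bits 7 -> pt, generic P &
  (ncross P (weight (m := 4)) <= 8 * (71 * 128))%N.
Proof.
have [P [sgP [_ _ gP _]]] := perturb base_config.
exists P; first by move=> x y z; apply: gP.
rewrite (ncross_perturb (P := base_config)) //; last exact: base_edge_side.
by rewrite ncross_base; have := base_count_edges; lia.
Qed.

End Base.

Local Close Scope ring_scope.
Local Open Scope nat_scope.

Lemma weight_regular m : regular_weight (m.+1 + 3) (weight (m := m.+1))
  (inner (m := m.+1)) (outer (m := m.+1)).
Proof. by elim: m => [|m IH]; [exact: base_regular|exact: ext_regular]. Qed.

(** * Induction on the dimension of the quotient *)

Section Growth.
Variables (R : realFieldType) (V : finType) (k : nat) (w : V -> V -> nat) (I J : V -> V -> bool).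
Hypothesis H : regular_weight k w I J.
Hypothesis cardV : #|V| = 2 ^ k.
Hypothesis k2 : 1 < k.
Variable P : V -> R * R * R.
Hypothesis gP : generic P.

(* [N] is eight times the crossing number:
   the bound is [13/16 4^k - (2k^2 + 4k + 6) 2^(k-2)] on [N / 8]. *)
Definition crossing_bound k N : bool :=
  2 * N + 2 ^ (k + 2) * (2 * k ^ 2 + 4 * k + 6) <= 13 * 4 ^ k.

(** The polynomial [q(k) = 2k^2 + 4k + 6] satisfies [2 q(k) = q(k + 1) + 2k^2], so the bound
    reproduces itself without loss. *)
Lemma crossing_boundS N N' : crossing_bound k N -> N' <= 4 * N + 2 ^ k * (8 * k ^ 2) ->
  crossing_bound k.+1 N'.
Proof.
rewrite /crossing_bound !addn2 !expnS; move: (2 ^ k) (4 ^ k) => a b.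
by rewrite !expn0 !muln1; nia.
Qed.

Lemma double_regular (w' : V * bool -> V * bool -> nat) :
  (forall p q, w' p q = w' q p) ->
  (forall x y i, x != y -> w' (x, i) (y, false) + w' (x, i) (y, true) = w x y) ->
  (forall x y i j, w' (x, ~~ i) (y, ~~ j) = w' (x, i) (y, j)) ->
  (forall x i, \sum_(y | y != x) \sum_j w' (x, i) (y, j) ^ 2 <= k.*2 + 2) ->
  crossing_bound k (ncross P w) ->
  exists2 P' : V * bool -> R * R * R, generic P' & crossing_bound k.+1 (ncross P' w').
Proof.
move=> h1 h2 h3 h4 b.
have [|P' gP' N'] := @doubling R V P w w' k _ gP (rw_refl H) (rw_le2 H) (rw_sum H)
  (rw_sqr H) h1 h2 h3 h4.
  by rewrite cardV (@leq_trans (2 ^ 2)) // leq_exp2l.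
by exists P' => //; apply: crossing_boundS b _; rewrite -cardV.
Qed.

Lemma double_ext_weight : crossing_bound k (ncross P w) ->
  exists2 P' : V * bool -> R * R * R, generic P' & crossing_bound k.+1 (ncross P' (ext_weight w I)).
Proof.
apply: double_regular.
- exact: rw_sym (ext_regular H).
- by move=> x y i xy; apply: (ext_weight_fiber H).
- by move=> x y i j; rewrite /ext_weight /= (eqtype.inj_eq negb_inj).
- by move=> x i; apply: (ext_weight_sqr H).
Qed.

Lemma double_ext_last : crossing_bound k (ncross P w) ->
  exists2 P' : V * bool -> R * R * R, generic P' & crossing_bound k.+1 (ncross P' (ext_last w I J)).
Proof.
apply: double_regular.
- move=> [x i] [y j]; rewrite /ext_last /= eq_sym [i == j]eq_sym (rw_sym H) (rw_Isym H) (rw_Jsym H).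
  by [].
- by move=> x y i xy; apply: (ext_last_fiber H).
- by move=> x y i j; rewrite /ext_last /= !(eqtype.inj_eq negb_inj).
- by move=> x i; apply: (ext_last_sqr H).
Qed.

End Growth.

Lemma weight_drawing (R : realFieldType) m : exists2 P : bits (m.+4 + 3) -> R * R * R,
  generic P & crossing_bound (m.+4 + 3) (ncross P (weight (m := m.+4))).
Proof.
elim: m => [|m [P gP b]].
  have [P gP b] := base_drawing R; exists P => //.
  by move: b; rewrite /crossing_bound; move: (ncross _ _) => N; lia.
exact: (double_ext_weight (weight_regular m.+3) (card_bits _) _ gP b).
Qed.

Lemma last_drawing (R : realFieldType) m : exists2 P : bits (m.+4.+1 + 3) -> R * R * R,
  generic P & crossing_bound (m.+4.+1 + 3) (ncross P (weight_last (m := m.+4))).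
Proof.
have [P gP b] := weight_drawing R m.
exact: (double_ext_last (weight_regular m.+3) (card_bits _) _ gP b).
Qed.

(** * The vertices of the augmented cube *)

Fixpoint of_word k (s : seq bool) : bits k :=
  if k is k1.+1 then (of_word k1 (behead s), head false s) else tt.

Lemma of_wordK k s : size s = k -> word (of_word k s) = s.
Proof. by elim: k s => [|k IH] [|b s] //= [/IH ->]. Qed.

Lemma of_word_eq k s s' : size s = k -> size s' = k ->
  (of_word k s == of_word k s') = (s == s').
Proof. by move=> h h'; rewrite -(eqtype.inj_eq (@word_inj k)) !of_wordK. Qed.

(* Consecutive sums; this linear change of coordinates turns the generators of the
   augmented cube into single letters and pairs of adjacent letters. *)
Fixpoint sums (b : bool) (s : seq bool) : seq bool :=
  if s is a :: s1 then addb b a :: sums a s1 else [::].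

Lemma size_sums b s : size (sums b s) = size s.
Proof. by elim: s b => //= a s IH b; rewrite IH. Qed.

Lemma sums_inj b : injective (sums b).
Proof.
move=> s t; elim: s b t => [|a s IH] b [|c t] //= [/addbI -> h]; congr (_ :: _).
exact: IH h.
Qed.

Lemma sums_negb b s : sums (~~ b) [seq ~~ a | a <- s] = sums b s.
Proof. by elim: s b => //= a s IH b; rewrite IH addbN addNb negbK. Qed.

Fixpoint fan_adj (x y : seq bool) : bool :=
  match x, y with
  | a :: x1, b :: y1 => if a == b then fan_adj x1 y1
      else (x1 == y1) || (if (x1, y1) is (c :: x2, d :: y2) then (c != d) && (x2 == y2) else false)
  | _, _ => false
  end.

(** Complementing a suffix changes one consecutive sum; flipping one letter changes two neighbouring
    sums, or one if it is the last letter. *)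
Lemma aq_adj_fan b x y : aq_adj x y -> fan_adj (sums b x) (sums b y).
Proof.
elim: x y b => [|a x IH] [|c y] b //; first by case: x {IH}.
have [->|ac] := eqVneq a c.
  move=> h; have {}h : aq_adj x y by case: x y h {IH} => [|a1 x] [|c1 y] //=; rewrite eqxx.
  by rewrite /= eqxx; apply: IH.
move=> h; have {}h : (x == y) || (x == map negb y).
  by case: x y h {IH} => [|a1 x] [|c1 y] //=; rewrite (negbTE ac).
rewrite /= (eqtype.inj_eq (@addbI b)) (negbTE ac).
have -> : a = ~~ c by move: ac; case: a; case: c.
clear ac.
case/orP: h => /eqP ->.
  by case: y {IH} => [|d y] //=; rewrite eqxx orbC -addNb; case: c; case: d.
by rewrite sums_negb eqxx.
Qed.

Lemma fan_adj_neq x y : fan_adj x y -> x != y.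
Proof.
elim: x y => [|a x IH] [|b y] //=; rewrite eqseq_cons.
by case: (a == b) => //= /IH.
Qed.

(** The generators not involving the gap: each letter next to the gap loses the unit that stands for
    its pair with a gap letter. When the gap is closed, these are the edges that fix the new
    letter. *)
Definition simple m (p q : bits (m + 3)) : nat := weight p q - inner p q - outer p q.

Lemma simpleS m (x y : bits (m + 3)) i j : x != y ->
  simple (m := m.+1) (x, i) (y, j) = if i == j then simple x y else inner x y.
Proof.
move=> xy; rewrite /simple /= /ext_weight /ext_inner /ext_outer /= (negbTE xy) subn0.
by case: (i == j); rewrite /= ?subn0.
Qed.

Lemma simple_head m (x : bits (m + 3)) i j : i != j -> 0 < simple (m := m.+1) (x, i) (x, j).
Proof.
by move=> ij; rewrite /simple /= /ext_weight /ext_inner /ext_outer /= eqxx (negbTE ij).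
Qed.

Section Tail.
Variables a0 a1 : bool.
Local Notation ow m r a := (of_word (m + 3) (r ++ a)).

Lemma simple_fan m r r' a : size r = m -> size r' = m -> size a = 3 -> fan_adj r r' ->
  0 < simple (ow m r a) (ow m r' a).
Proof.
move=> + + sa; elim: m r r' => [|m IH] [|b r] [|c r'] // [sr] [sr'] /=.
have eqow s s' : size s = m -> size s' = m -> (ow m s a == ow m s' a) = (s == s').
  move=> h h'; rewrite of_word_eq ?size_cat ?h ?h' ?sa //.
  by rewrite eqseq_cat ?h // eqxx andbT.
have [<-|bc] := eqVneq b c => h.
  have ne := fan_adj_neq h; rewrite simpleS ?eqow // eqxx.
  exact: IH.
have [e|ne] := eqVneq r r'; first by subst r'; apply: simple_head.
move: h; rewrite (negbTE ne) /= => h; rewrite simpleS ?eqow // (negbTE bc).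
case: m sr sr' IH {eqow} => [|m] sr sr' IH; first by case: r sr ne h; case: r' sr'.
case: r sr ne h => // d r sr; case: r' sr' => // d' r' sr' ne /andP[dd /eqP e].
by subst r'; rewrite /= /ext_inner /= eqxx dd.
Qed.

Lemma simple_tail m r a a' : size r = m -> size a = 3 -> size a' = 3 -> fan_adj (rev a) (rev a') ->
  0 < simple (ow m r a) (ow m r a').
Proof.
move=> + sa sa' h; elim: m r => [|m IH] [|b r] // sr.
  case: a sa h => [|x2 [|x1 [|x0 []]]] //= _; case: a' sa' => [|y2 [|y1 [|y0 []]]] //= _.
  by case: x0; case: y0; case: x1; case: y1; case: x2; case: y2.
case: sr => sr; have ne : ow m r a != ow m r a'.
  rewrite of_word_eq ?size_cat ?sr ?sa ?sa' // eqseq_cat // eqxx /=.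
  by have := fan_adj_neq h; apply: contraNN => /eqP ->.
by rewrite /= simpleS // eqxx IH.
Qed.

Lemma outer_tail m r x y : size r = m -> x != y ->
  outer (ow m r [:: x; a1; a0]) (ow m r [:: y; a1; a0]).
Proof.
move=> + xy; elim: m r => [|m IH] [|b r] // sr /=.
  by rewrite /ext_inner /= eqxx.
by case: sr => sr; rewrite /ext_outer /= eqxx IH.
Qed.

End Tail.

(* Puts the letters in the order of [ext_weight], with the gap after the third one. *)
Definition fold_word (s : seq bool) : seq bool := drop 3 s ++ rev (take 3 s).

Lemma size_fold_word s : size (fold_word s) = size s.
Proof. by rewrite size_cat size_rev addnC -size_cat cat_take_drop. Qed.

Lemma fold_word_inj s t : 2 < size s -> fold_word s = fold_word t -> s = t.
Proof.
move=> ss e; have st : size s = size t by rewrite -size_fold_word e size_fold_word.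
move/eqP: e; rewrite /fold_word eqseq_cat ?size_drop ?st // => /andP[/eqP e1 /eqP e2].
by rewrite -(cat_take_drop 3 s) -(cat_take_drop 3 t) e1 (can_inj revK e2).
Qed.

Lemma weight_lastE m (p q : bits (m + 3)) b d : weight_last (m := m) (p, b) (q, d) =
  if p == q then (b != d : nat) else if b == d then simple p q else inner p q + outer p q.
Proof. by []. Qed.

(** Positive weights make the augmented cube a subgraph of the last weighted graph, which suffices
    for an upper bound. The cases follow the first letter in which the words differ: the pair of the
    third and fourth letters comes from [outer], that of the fourth and fifth from [inner], and the
    other generators avoiding the fourth letter from [simple]. *)
Lemma fan_weight_last m s t : size s = m.+2 + 3 -> size t = m.+2 + 3 -> fan_adj s t ->
  0 < weight_last (m := m.+1) (of_word (m.+2 + 3) (fold_word s)) (of_word (m.+2 + 3) (fold_word t)).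
Proof.
move=> ss st; have {ss} : size s = m.+1.+4 by rewrite ss addn3.
have {st} : size t = m.+1.+4 by rewrite st addn3.
case: s => [|a0 [|a1 [|a2 [|b r]]]] //; case: t => [|c0 [|c1 [|c2 [|d u]]]] // [su] [sr].
have fw x0 x1 x2 w : fold_word [:: x0, x1, x2 & w] = w ++ [:: x2; x1; x0].
  by rewrite /fold_word /= ?drop0 ?take0.
rewrite !fw.
pose p := of_word (m.+1 + 3) (r ++ [:: a2; a1; a0]).
pose q := of_word (m.+1 + 3) (u ++ [:: c2; c1; c0]).
move=> h; change (0 < weight_last (m := m.+1) (p, b) (q, d)).
have pq : (p == q) = (r == u) && ([:: a2; a1; a0] == [:: c2; c1; c0]).
  by rewrite of_word_eq ?size_cat ?sr ?su ?addn3 // eqseq_cat ?sr ?su.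
have tail : r = u -> fan_adj [:: a0; a1; a2] [:: c0; c1; c2] -> 0 < simple p q /\ p != q.
  move=> ru f; subst u; split; first exact: simple_tail.
  rewrite pq eqxx /=; have := fan_adj_neq f; apply: contraNN.
  by rewrite !eqseq_cons !andbT => /and3P[-> -> ->].
rewrite weight_lastE.
have fin : 0 < simple p q /\ p != q -> b = d -> 0 < (if p == q then (b != d : nat) else
    if b == d then simple (m := m.+1) p q
    else inner (m := m.+1) p q + outer (m := m.+1) p q).
  by move=> [h1 /negbTE ->] ->; rewrite eqxx.
move: h; rewrite [fan_adj _ _]/=; have [e0|n0] := eqVneq a0 c0; last first.
  rewrite !eqseq_cons => h.
  have [bd ru] : b = d /\ r = u.
    by case/orP: h => [/and4P[_ _ /eqP-> /eqP->]|/andP[_ /and3P[_ /eqP-> /eqP->]]].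
  apply: fin => //; apply: tail => //; rewrite /= (negbTE n0) !eqseq_cons.
  by move: h; rewrite bd ru !eqxx !andbT.
have [e1|n1] := eqVneq a1 c1; last first.
  rewrite !eqseq_cons => h.
  have [bd ru] : b = d /\ r = u.
    by case/orP: h => [/and3P[_ /eqP-> /eqP->]|/andP[_ /andP[/eqP-> /eqP->]]].
  apply: fin => //; apply: tail => //; rewrite /= e0 eqxx (negbTE n1) !eqseq_cons.
  by move: h; rewrite bd ru !eqxx !andbT.
have [e2|n2] := eqVneq a2 c2; last first.
  rewrite !eqseq_cons => /orP[/andP[/eqP bd /eqP ru]|/andP[bd /eqP ru]].
    apply: fin => //; apply: tail => //.
    by rewrite /= e0 e1 !eqxx (negbTE n2).
  rewrite pq ru e0 e1 !eqseq_cons (negbTE n2) andbF (negbTE bd) addn_gt0.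
  have -> : outer (m := m.+1) p q by rewrite /p /q ru e0 e1; apply: outer_tail.
  by rewrite orbT.
have [bd|bd] := eqVneq b d => h.
  rewrite pq (negbTE (fan_adj_neq h)) /=.
  by rewrite /p /q e0 e1 e2; apply: simple_fan.
have [ru|ru] := eqVneq r u; first by rewrite pq ru e0 e1 e2 !eqxx.
have -> : inner (m := m.+1) p q.
  move: h; rewrite (negbTE ru) /= /p /q e0 e1 e2.
  case: r sr ru {p q pq tail fin} => [|x r] // sr ru.
  case: u su ru => [|y u] // su ru /andP[xy /eqP e].
  by rewrite /= /ext_inner /= e eqxx xy.
by rewrite pq (negbTE ru).
Qed.

(** * From spherical arcs to plane curves *)

From mathcomp Require Import all_classical all_reals all_analysis.
Import numFieldNormedType.Exports.
Local Open Scope classical_set_scope.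
Local Open Scope ring_scope.

Section Projection.
Variable R : realType.
Local Notation pt := (R * R * R)%type.

Definition hnorm (u : pt) : R := `|u.1.1| + `|u.1.2|.

(* A bijection from the rays off the third axis onto the punctured plane. *)
Definition proj (u : pt) : R * R :=
  (expR (u.2 / hnorm u) * (u.1.1 / hnorm u), expR (u.2 / hnorm u) * (u.1.2 / hnorm u)).

Definition scale (l : R) (u : pt) : pt := (l * u.1.1, l * u.1.2, l * u.2).

(** The chord replaces the minor arc: both span the same rays, and [proj] depends only on the
    ray. *)
Definition seg (u v : pt) (t : R) : pt :=
  ((1 - t) * u.1.1 + t * v.1.1, (1 - t) * u.1.2 + t * v.1.2, (1 - t) * u.2 + t * v.2).

Lemma seg0 u v : seg u v 0 = u.
Proof. by case: u => [[a b] c]; rewrite /seg /= !mul0r !subr0 !mul1r !addr0. Qed.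
Lemma seg1 u v : seg u v 1 = v.
Proof. by case: v => [[a b] c]; rewrite /seg /= !subrr !mul0r !mul1r !add0r. Qed.

(** The 1-norm of [proj u] is [expR (u.2 / hnorm u)], which gives back the height; division by it
    gives back the horizontal part. *)
Lemma proj_inj u v : 0 < hnorm u -> 0 < hnorm v -> proj u = proj v ->
  exists2 l, 0 < l & u = scale l v.
Proof.
move=> u0 v0 [e1 e2]; exists (hnorm u / hnorm v); first exact: divr_gt0.
have nE w : 0 < hnorm w ->
    `|expR (w.2 / hnorm w) * (w.1.1 / hnorm w)| + `|expR (w.2 / hnorm w) * (w.1.2 / hnorm w)|
    = expR (w.2 / hnorm w).
  move=> w0; rewrite !normrM !normfV (gtr0_norm (expR_gt0 _)) -mulrDr -mulrDl.
  by rewrite [`|hnorm w|]gtr0_norm // -/(hnorm w) divff ?mulr1 // gt_eqF.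
have e3 : expR (u.2 / hnorm u) = expR (v.2 / hnorm v) by rewrite -nE // e1 e2 nE.
have e4 : u.2 / hnorm u = v.2 / hnorm v by apply: expR_inj.
rewrite e3 in e1 e2.
have ex0 : expR (v.2 / hnorm v) != 0 by rewrite gt_eqF ?expR_gt0.
have {}e1 := mulfI ex0 e1; have {}e2 := mulfI ex0 e2.
have h a b : a / hnorm u = b / hnorm v -> a = hnorm u / hnorm v * b.
  move=> e; have -> : hnorm u / hnorm v * b = hnorm u * (b / hnorm v) by ring.
  by rewrite -e mulrC mulfVK // gt_eqF.
by rewrite /scale -(h _ _ e1) -(h _ _ e2) -(h _ _ e4); case: (u) => [[]].
Qed.

Lemma hnorm_seg u v t : det2 u v != 0 -> 0 < hnorm (seg u v t).
Proof.
move=> d0; rewrite lt_neqAle; apply/andP; split; last by rewrite addr_ge0.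
apply: contra d0; rewrite eq_sym /hnorm paddr_eq0 // !normr_eq0 => /andP[/eqP h1 /eqP h2].
rewrite /seg /= in h1 h2; apply/eqP.
have k1 : (1 - t) * det2 u v = 0.
  have -> : (1 - t) * det2 u v =
      ((1 - t) * u.1.1 + t * v.1.1) * v.1.2 - ((1 - t) * u.1.2 + t * v.1.2) * v.1.1.
    by rewrite /det2; ring.
  by rewrite h1 h2 !mul0r subrr.
have k2 : t * det2 u v = 0.
  have -> : t * det2 u v =
      u.1.1 * ((1 - t) * u.1.2 + t * v.1.2) - u.1.2 * ((1 - t) * u.1.1 + t * v.1.1).
    by rewrite /det2; ring.
  by rewrite h1 h2 !mulr0 subrr.
lra.
Qed.

Lemma continuous_proj_seg u v : det2 u v != 0 -> continuous (fun t => proj (seg u v t)).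
Proof.
move=> d0 t.
have lin (a b : R) : {for t, continuous (fun t : R => (1 - t) * a + t * b)}.
  apply: continuousD; apply: continuousM; try exact: cvg_cst; try exact: cvg_id.
  by apply: continuousB; [exact: cvg_cst|exact: cvg_id].
have n0 : hnorm (seg u v t) != 0 by rewrite gt_eqF ?hnorm_seg.
have cn : {for t, continuous (fun t : R => (hnorm (seg u v t))^-1)}.
  apply: continuousV => //; rewrite /hnorm.
  apply: continuousD.
    by apply: (@continuous_comp _ _ _ (fun t : R => (seg u v t).1.1) (fun x : R => `|x|));
      [exact: lin|exact: norm_continuous].
  by apply: (@continuous_comp _ _ _ (fun t : R => (seg u v t).1.2) (fun x : R => `|x|));
      [exact: lin|exact: norm_continuous].
have ce : {for t, continuous (fun t : R => expR ((seg u v t).2 / hnorm (seg u v t)))}.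
  apply: (@continuous_comp _ _ _ (fun t : R => (seg u v t).2 / hnorm (seg u v t)) expR);
    last exact: continuous_expR.
  exact: (continuousM (lin _ _) cn).
pose f1 t := expR ((seg u v t).2 / hnorm (seg u v t)) * ((seg u v t).1.1 / hnorm (seg u v t)).
pose f2 t := expR ((seg u v t).2 / hnorm (seg u v t)) * ((seg u v t).1.2 / hnorm (seg u v t)).
have c1 : {for t, continuous f1} by exact: (continuousM ce (continuousM (lin _ _) cn)).
have c2 : {for t, continuous f2} by exact: (continuousM ce (continuousM (lin _ _) cn)).
exact: (@cvg_pair R R R (nbhs t) (nbhs (f1 t)) (nbhs (f2 t)) _ _ _ f1 f2 c1 c2).
Qed.

End Projection.

Section Arcs.
Variable R : realType.
Local Notation pt := (R * R * R)%type.

Lemma det3_segr (u v a b : pt) t :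
  det3 u v (seg a b t) = (1 - t) * det3 u v a + t * det3 u v b.
Proof. by rewrite /det3 /dot /vprod /seg /=; ring. Qed.

Lemma det3_scaler (u v a : pt) l : det3 u v (scale l a) = l * det3 u v a.
Proof. by rewrite /det3 /dot /vprod /scale /=; ring. Qed.

(** The common point is paired with the planes of [(a, b)], [(c, d)] and [(c, a)]. The third
    relation carries the sign of [l], which tells a true crossing from a meeting with the antipodal
    arc. *)
Lemma seg_relations (a b c d : pt) t s l : l != 0 ->
  seg a b t = scale l (seg c d s) ->
  [/\ (1 - s) * det3 a b c + s * det3 a b d = 0,
      (1 - t) * det3 c d a + t * det3 c d b = 0
    & t * det3 a b c = - (l * s * det3 c d a)].
Proof.
move=> l0 E; split.
- have := congr1 (det3 a b) E; rewrite det3_segr det3_scaler det3_segr det3_eq13 det3_eq23.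
  by rewrite !mulr0 addr0 => /esym/eqP; rewrite mulf_eq0 (negbTE l0) => /eqP.
- have := congr1 (det3 c d) E; rewrite det3_segr det3_scaler det3_segr det3_eq13 det3_eq23.
  by rewrite !mulr0 addr0 mulr0.
- have := congr1 (det3 c a) E; rewrite det3_segr det3_scaler det3_segr.
  rewrite det3_eq23 det3_eq13 !mulr0 !add0r -(det3_rot c a b) => ->.
  by rewrite (det3C23 c d a) !mulrN mulrA.
Qed.

Lemma seg_crossb (a b c d : pt) t s l : 0 < t < 1 -> 0 < s < 1 -> 0 < l ->
  det3 a b c != 0 -> det3 a b d != 0 -> det3 c d a != 0 -> det3 c d b != 0 ->
  seg a b t = scale l (seg c d s) -> crossb a b c d.
Proof.
move=> /andP[t0 t1] /andP[s0 s1] l0 A0 B0 C0 D0 /(seg_relations (lt0r_neq0 l0)).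
rewrite /crossb; move: A0 B0 C0 D0.
move: (det3 a b c) (det3 a b d) (det3 c d a) (det3 c d b) => A B C D A0 B0 C0 D0 [h1 h2 h3].
have sq (x : R) : x != 0 -> 0 < x ^+ 2 by move=> x0; rewrite exprn_even_gt0.
apply/and3P; split.
- rewrite -(pmulr_rlt0 _ (_ : 0 < 1 - s)) ?subr_gt0 //.
  have -> : (1 - s) * (A * B) = ((1 - s) * A + s * B) * B - s * B ^+ 2 by ring.
  by rewrite h1 mul0r add0r oppr_lt0 mulr_gt0 ?sq.
- rewrite -(pmulr_rlt0 _ (_ : 0 < 1 - t)) ?subr_gt0 //.
  have -> : (1 - t) * (C * D) = ((1 - t) * C + t * D) * D - t * D ^+ 2 by ring.
  by rewrite h2 mul0r add0r oppr_lt0 mulr_gt0 ?sq.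
- rewrite -(pmulr_rlt0 _ t0); have -> : t * (A * C) = (t * A) * C by ring.
  rewrite h3 mulNr oppr_lt0 (_ : l * s * C * C = (l * s) * C ^+ 2); last by ring.
  by rewrite mulr_gt0 ?sq // mulr_gt0.
Qed.

Lemma plane_det0 (a b c d e f u : pt) : u != 0 ->
  det3 a b u = 0 -> det3 c d u = 0 -> det3 e f u = 0 -> plane_det a b c d e f = 0.
Proof.
move=> u0 h1 h2 h3; apply/eqP; apply: contraNT u0 => D0; apply/eqP.
(* Cramer's rule: a vector orthogonal to three independent normals is zero. *)
have id n1 n2 n3 (p : pt) : scale (det3 n1 n2 n3) p =
    translate (translate (scale (dot n1 p) (vprod n2 n3)) (dot n2 p) (vprod n3 n1))
      (dot n3 p) (vprod n1 n2).
  by rewrite /scale /translate /det3 /dot /vprod /=; congr (_, _, _); ring.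
have := id (vprod a b) (vprod c d) (vprod e f) u.
rewrite -/(plane_det a b c d e f) -/(det3 a b u) -/(det3 c d u) -/(det3 e f u) h1 h2 h3.
rewrite /translate /scale /= !mul0r !addr0; case: u {h1 h2 h3} => [[x y] z] /= [e1 e2 e3].
have z0 w : plane_det a b c d e f * w = 0 -> w = 0.
  by move/eqP; rewrite mulf_eq0 (negbTE D0) => /eqP.
by rewrite (z0 x) // (z0 y) // (z0 z).
Qed.

Lemma seg_inj (a b : pt) t s l : det2 a b != 0 -> seg a b t = scale l (seg a b s) ->
  t = s /\ l = 1.
Proof.
move=> d0 E.
have e1 : (1 - t) * det2 a b = l * (1 - s) * det2 a b.
  have := congr1 (fun p => det2 p b) E; rewrite /det2 /seg /scale /= => h; lra.
have e2 : t * det2 a b = l * s * det2 a b.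
  have := congr1 (fun p => det2 a p) E; rewrite /det2 /seg /scale /= => h; lra.
have {}e1 := mulIf d0 e1; have {}e2 := mulIf d0 e2.
have l1 : l = 1 by lra.
by split=> //; rewrite e2 l1 mul1r.
Qed.

End Arcs.

Section Drawing.
Variables (R : realType) (T : finType) (G : sgraph T) (P : T -> R * R * R).
Hypothesis gP : strongly_generic predT P.

Let g2 x y : x != y -> det2 (P x) (P y) != 0.
Proof. by case: gP => _ h _ _; apply: h. Qed.
Let g3 x y z : x != y -> y != z -> x != z -> det3 (P x) (P y) (P z) != 0.
Proof. by case: gP => _ _ h _; apply: h. Qed.

Definition ends (e : {set T}) : (R * R * R) * (R * R * R) :=
  if enum e is [:: a, b & _] then (P a, P b) else (0, 0).

Definition arcs : drawing R T :=
  Drawing (fun v => proj (P v)) (fun e t => proj (seg (ends e).1 (ends e).2 t)).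

Lemma edge_arc e : e \in edges G -> exists a b,
  [/\ adj G a b, a != b, e = [set a; b]%SET & forall t, curve arcs e t = proj (seg (P a) (P b) t)].
Proof.
case/imsetP => -[x y]; rewrite inE /= => xy ->.
have ne : x != y by apply: contraTneq xy => ->; rewrite adj_irr.
have sz : size (enum [set x; y]%SET) = 2 by rewrite -cardE cards2 ne.
have un := enum_uniq [set x; y]%SET.
have mem z : z \in enum [set x; y]%SET = (z == x) || (z == y) by rewrite mem_enum !inE.
rewrite /arcs /= /ends; case: (enum _) sz un mem => [|a [|b [|]]] //= _.
rewrite inE andbT => ab mem.
have : a \in [:: a; b] by rewrite mem_head.
have : b \in [:: a; b] by rewrite !inE eqxx orbT.
rewrite !mem => /orP[]/eqP eb /orP[]/eqP ea; subst a b; rewrite ?eqxx // in ab *.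
- by exists y, x; split=> //; [rewrite adj_sym|rewrite finset.setUC].
- by exists x, y; split.
Qed.

Lemma hnorm_gt0 x : 0 < hnorm (P x).
Proof.
have : (P x).1.1 != 0 by case: gP => h _ _ _; apply: h.
by rewrite /hnorm => h; rewrite ltr_wpDr ?normr_gt0.
Qed.

Lemma crossing_segs a b c d p : a != b -> c != d ->
  ((fun t => proj (seg (P a) (P b) t)) @` `]0, 1[) p ->
  ((fun t => proj (seg (P c) (P d) t)) @` `]0, 1[) p ->
  exists t s l, [/\ 0 < t < 1, 0 < s < 1, 0 < l, p = proj (seg (P c) (P d) s)
    & seg (P a) (P b) t = scale l (seg (P c) (P d) s)].
Proof.
move=> ab cd [t /= t01 <-] [s /= s01 /esym e].
rewrite in_itv /= in t01; rewrite in_itv /= in s01.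
by have [l l0 E] := proj_inj (hnorm_seg t (g2 ab)) (hnorm_seg s (g2 cd)) e; exists t, s, l.
Qed.

(** If one end of [cd] were [a] or [b], the first of [seg_relations] would put the other end in the
    plane of [(a, b)] too; by genericity it would be [a] or [b], and the two edges would
    coincide. *)
Lemma crossing_disjoint a b c d p : a != b -> c != d -> [set a; b]%SET != [set c; d]%SET ->
  ((fun t => proj (seg (P a) (P b) t)) @` `]0, 1[) p ->
  ((fun t => proj (seg (P c) (P d) t)) @` `]0, 1[) p ->
  [/\ c != a, c != b, d != a & d != b].
Proof.
move=> ab cd ne h1 h2; have [t [s [l [_ /andP[s0 s1] l0 _ E]]]] := crossing_segs ab cd h1 h2.
have [r1 _ _] := seg_relations (lt0r_neq0 l0) E.
have ba : b != a by rewrite eq_sym.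
have z x : (x == a) || (x == b) -> det3 (P a) (P b) (P x) = 0.
  by case/orP => /eqP ->; rewrite ?det3_eq13 ?det3_eq23.
have nz x : det3 (P a) (P b) (P x) = 0 -> (x == a) || (x == b).
  move/eqP; apply: contraTT; rewrite negb_or => /andP[xa xb].
  by apply: g3 => //; rewrite eq_sym.
have both : ~~ (((c == a) || (c == b)) && ((d == a) || (d == b))).
  apply/negP => /andP[hc hd]; move: ne cd.
  by case/orP: hc => /eqP ->; case/orP: hd => /eqP ->; rewrite ?eqxx // finset.setUC eqxx.
have hc : ~~ ((c == a) || (c == b)).
  apply: contraNN both => hc; rewrite hc; apply: nz.
  by move: r1; rewrite (z _ hc) mulr0 add0r => /eqP; rewrite mulf_eq0 gt_eqF //= => /eqP.
have hd : ~~ ((d == a) || (d == b)).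
  apply: contraNN both => hd; rewrite hd andbT; apply: nz.
  by move: r1; rewrite (z _ hd) mulr0 addr0 => /eqP; rewrite mulf_eq0 subr_eq0 gt_eqF //= => /eqP.
by move: hc hd; rewrite !negb_or => /andP[-> ->] /andP[-> ->].
Qed.

Lemma crossing_crossb a b c d p : a != b -> c != d -> [set a; b]%SET != [set c; d]%SET ->
  ((fun t => proj (seg (P a) (P b) t)) @` `]0, 1[) p ->
  ((fun t => proj (seg (P c) (P d) t)) @` `]0, 1[) p ->
  crossb (P a) (P b) (P c) (P d).
Proof.
move=> ab cd ne h1 h2; have [ca cb da db] := crossing_disjoint ab cd ne h1 h2.
have [t [s [l [t01 s01 l0 _ E]]]] := crossing_segs ab cd h1 h2.
by apply: (seg_crossb t01 s01 l0 _ _ _ _ E); apply: g3 => //; rewrite eq_sym.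
Qed.

Lemma arcs_is_drawing : is_drawing G arcs.
Proof.
split.
- move=> x y /= /(proj_inj (hnorm_gt0 x) (hnorm_gt0 y)) [l _ E]; apply/eqP.
  apply/negPn/negP => /g2; rewrite E /det2 /scale /=.
  by apply/negP; rewrite negbK; apply/eqP; ring.
- move=> e /edge_arc[a [b [_ ab _ E]]].
  rewrite (_ : curve arcs e = fun t => proj (seg (P a) (P b) t)); last exact/funext.
  by apply: continuous_subspaceT; exact: continuous_proj_seg (g2 ab).
- move=> e /edge_arc[a [b [_ ab -> E]]].
  rewrite !E seg0 seg1; apply/seteqP; split=> p /=.
    by case=> ->; [exists a|exists b] => //=; rewrite !inE eqxx ?orbT.
  by case=> v /= ; rewrite !inE => /orP[]/eqP -> <-; [left|right].
- move=> e v t /edge_arc[a [b [_ ab _ E]]] /andP[t0 t1]; rewrite E => h.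
  have [l l0 Es] := proj_inj (hnorm_seg t (g2 ab)) (hnorm_gt0 v) h.
  have ba : b != a by rewrite eq_sym.
  have d0 : det3 (P a) (P b) (P v) = 0.
    have := congr1 (det3 (P a) (P b)) Es; rewrite det3_segr det3_scaler det3_eq13 det3_eq23.
    by rewrite !mulr0 addr0 => /esym/eqP; rewrite mulf_eq0 gt_eqF //= => /eqP.
  have [va|va] := eqVneq v a.
    subst v; rewrite -[P a in RHS](seg0 _ (P b)) in Es.
    by have [t00 _] := seg_inj (g2 ab) Es; rewrite t00 ltxx in t0.
  have [vb|vb] := eqVneq v b.
    subst v; rewrite -[P b in RHS](seg1 (P a)) in Es.
    by have [t11 _] := seg_inj (g2 ab) Es; rewrite t11 ltxx in t1.
  have bv : b != v by rewrite eq_sym.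
  have av : a != v by rewrite eq_sym.
  by have := g3 ab bv av; rewrite d0 eqxx.
Qed.

Definition arc_of a b : set (R * R) := (fun t => proj (seg (P a) (P b) t)) @` `]0, 1[.

Lemma edge_arc_of e : e \in edges G -> exists a b,
  [/\ adj G a b, a != b, e = [set a; b]%SET, forall t, curve arcs e t = proj (seg (P a) (P b) t) &
    curve arcs e @` `]0, 1[ = arc_of a b].
Proof.
move=> /edge_arc[a [b [Gab ab ee E]]]; exists a, b; split=> //.
by congr (_ @` _); apply/funext.
Qed.

Lemma arcs_is_good : is_good G arcs.
Proof.
split.
- move=> e /edge_arc[a [b [_ ab _ E]]] t s _ _; rewrite !E => h.
  have [l l0 Es] := proj_inj (hnorm_seg t (g2 ab)) (hnorm_seg s (g2 ab)) h.
  by have [] := seg_inj (g2 ab) Es.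
- move=> e f /edge_arc_of[a [b [_ ab ee _ E]]] /edge_arc_of[c [d [_ cd ff _ F]]] ne nd.
  apply/seteqP; split=> // p; rewrite /crossing_points E F => -[h1 h2].
  move: ne nd; rewrite ee ff => ne.
  have [ca cb da db] := crossing_disjoint ab cd ne h1 h2.
  case/negP; rewrite disjoint_sym finset.disjoints_subset; apply/fintype.subsetP => x; rewrite !inE.
  by case/orP => /eqP ->; rewrite negb_or ?ca ?cb ?da ?db.
- move=> e f p q /edge_arc_of[a [b [_ ab ee _ E]]] /edge_arc_of[c [d [_ cd ff _ F]]] ne.
  rewrite /crossing_points E F => -[h1 h2] [k1 k2]; rewrite ee ff in ne.
  have [ca cb da db] := crossing_disjoint ab cd ne h1 h2.
  have [t [s [l [_ _ l0 -> E1]]]] := crossing_segs ab cd h1 h2.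
  have [t' [s' [l' [_ _ l0' -> E2]]]] := crossing_segs ab cd k1 k2.
  have [r1 _ _] := seg_relations (lt0r_neq0 l0) E1.
  have [r2 _ _] := seg_relations (lt0r_neq0 l0') E2.
  have /and3P[h _ _] := crossing_crossb ab cd ne h1 h2.
  suff -> : s = s' by [].
  move: r1 r2 h; move: (det3 _ _ _) (det3 _ _ _) => A B r1 r2 h.
  (* [A] and [B] have opposite signs, so the relation [(1 - s) A + s B = 0] determines [s]. *)
  have AB : A - B != 0.
    rewrite subr_eq0; apply: contraTneq h => ->.
    by rewrite -leNgt -expr2 sqr_ge0.
  apply: (mulIf AB); lra.
- move=> e f g p /edge_arc_of[a [b [_ ab ee _ E]]] /edge_arc_of[c [d [_ cd ff _ F]]].
  move=> /edge_arc_of[k [m [_ km gg _ K]]] ef eg fg.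
  rewrite /crossing_points E F K => -[[h1 h2] [_ h3]].
  rewrite ee ff in ef; rewrite ee gg in eg; rewrite ff gg in fg.
  have [ca cb da db] := crossing_disjoint ab cd ef h1 h2.
  have [ka kb ma mb] := crossing_disjoint ab km eg h1 h3.
  have [kc kd mc md] := crossing_disjoint cd km fg h2 h3.
  have := gP => -[_ _ _ /(_ a b c d k m isT)]; rewrite /= !inE !negb_or ab cd km.
  rewrite [a == c]eq_sym ca [a == d]eq_sym da [b == c]eq_sym cb [b == d]eq_sym db.
  rewrite [a == k]eq_sym ka [a == m]eq_sym ma [b == k]eq_sym kb [b == m]eq_sym mb.
  rewrite [c == k]eq_sym kc [c == m]eq_sym mc [d == k]eq_sym kd [d == m]eq_sym md.
  move=> /(_ isT)/negP; apply; apply/eqP.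
  case: h1 h2 h3 => t _ et [s _ es] [r _ er].
  have [l _ E1] := proj_inj (hnorm_seg t (g2 ab)) (hnorm_seg s (g2 cd)) (etrans et (esym es)).
  have [l' _ E2] := proj_inj (hnorm_seg t (g2 ab)) (hnorm_seg r (g2 km)) (etrans et (esym er)).
  apply: (plane_det0 (u := seg (P a) (P b) t)).
  - apply: contraTneq (hnorm_seg t (g2 ab)) => ->.
    by rewrite /hnorm /= normr0 addr0 ltxx.
  - by rewrite det3_segr det3_eq13 det3_eq23 !mulr0 addr0.
  - by rewrite E1 det3_scaler det3_segr det3_eq13 det3_eq23 !mulr0 addr0 mulr0.
  - by rewrite E2 det3_scaler det3_segr det3_eq13 det3_eq23 !mulr0 addr0 mulr0.
Qed.

(** Double counting: a crossing pair of edges has at least eight preimages under [phi], from the two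
    orders of the pair and the two orientations of each edge. *)
Lemma arcs_crossings (Q : T -> T -> nat) : (forall x y, adj G x y -> (0 < Q x y)%N) ->
  (8 * crossings G arcs <= ncross P Q)%N.
Proof.
move=> Qadj.
pose S := [set q : T * T * T * T | [&& adj G q.1.1.1 q.1.1.2, adj G q.1.2 q.2
  & crossb (P q.1.1.1) (P q.1.1.2) (P q.1.2) (P q.2)]]%SET.
have SQ : (#|S| <= ncross P Q)%N.
  rewrite /ncross -sum1_card big_mkcond /= !pair_bigA /=; apply: leq_sum => -[[[x y] z] t] _ /=.
  rewrite inE /=; case: ifP => // /and3P[/Qadj h1 /Qadj h2 ->].
  by rewrite muln1 muln_gt0 h1 h2.
apply: leq_trans SQ; rewrite /crossings.
set C := [set _ | _ : _ & _]%SET.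
pose phi (q : T * T * T * T) : {set {set T}} :=
  [set [set q.1.1.1; q.1.1.2]; [set q.1.2; q.2]]%SET.
have fiber c : c \in C -> (8 <= #|[set q in S | phi q == c]%SET|)%N.
  case/imsetP => -[e f]; rewrite inE /= => /and4P[he hf ne /asboolP[p]] + ->.
  move: he hf => /edge_arc_of[a [b [Gab ab ee _ E]]] /edge_arc_of[k [m [Gkm km ff _ F]]].
  rewrite /crossing_points E F => -[h1 h2]; rewrite ee ff in ne.
  have [ka kb ma mb] := crossing_disjoint ab km ne h1 h2.
  have X := crossing_crossb ab km ne h1 h2.
  pose L := [:: (a, b, k, m); (b, a, k, m); (a, b, m, k); (b, a, m, k);
                (k, m, a, b); (k, m, b, a); (m, k, a, b); (m, k, b, a)].
  have uL : uniq L.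
    rewrite /L /= !inE !xpair_eqE !eqxx [a == k]eq_sym [a == m]eq_sym [b == k]eq_sym [b == m]eq_sym.
    rewrite [b == a]eq_sym [m == k]eq_sym.
    by rewrite (negbTE ab) (negbTE km) (negbTE ka) (negbTE kb) (negbTE ma) (negbTE mb).
  have -> : 8%N = #|[set q in L]%SET| by rewrite cardsE (card_uniqP uL).
  apply: subset_leq_card; apply/fintype.subsetP => q; rewrite !inE /S /phi.
  have Gba : adj G b a by rewrite adj_sym.
  have Gmk : adj G m k by rewrite adj_sym.
  have bE : [set b; a]%SET = [set a; b]%SET by rewrite finset.setUC.
  have mE : [set m; k]%SET = [set k; m]%SET by rewrite finset.setUC.
  rewrite ee ff.
  have sE : [set [set k; m]; [set a; b]]%SET = [set [set a; b]; [set k; m]]%SET.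
    by rewrite finset.setUC.
  have X1 : crossb (P b) (P a) (P k) (P m) by rewrite crossbCl.
  have X2 : crossb (P a) (P b) (P m) (P k) by rewrite crossbCr.
  have X3 : crossb (P b) (P a) (P m) (P k) by rewrite crossbCl crossbCr.
  by case/or4P => [/eqP->|/eqP->|/eqP->|/or4P[/eqP->|/eqP->|/eqP->|/orP[]/eqP->]] /=;
    rewrite ?bE ?mE ?sE ?Gab ?Gba ?Gkm ?Gmk ?(crossbC (P a)) ?(crossbC (P b)) ?X ?X1 ?X2 ?X3 eqxx.
rewrite mulnC -sum_nat_const.
apply: (@leq_trans (\sum_(c in C) \sum_(q in S) (phi q == c))%N).
  apply: leq_sum => c /fiber; rewrite -sum1_card big_mkcond [X in _ -> (_ <= X)%N]big_mkcond /=.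
  move/leq_trans; apply; apply: leq_sum => q _.
  have -> : (q \in [set q in S | phi q == c]%SET) = (q \in S) && (phi q == c) by rewrite [LHS]inE.
  by case: (q \in S) => //=; case: eqP.
rewrite exchange_big -sum1_card; apply: leq_sum => q _ /=.
apply: (@leq_trans (\sum_c (phi q == c) * 1)%N); last by rewrite sum_delta.
by rewrite big_mkcond; apply: leq_sum => c _; case: (c \in C) => //; rewrite muln1.
Qed.

End Drawing.

Local Close Scope classical_set_scope.

(** * Transfer to the augmented cube and conclusion *)

Lemma sum_inj_le (T V : finType) (f : T -> V) (F : V -> nat) : injective f ->
  (\sum_x F (f x) <= \sum_y F y)%N.
Proof.
move=> fI; rewrite -(big_imset F (in2W fI)) /=.
by rewrite [leqRHS](bigID (mem [set f x | x in T]%SET)) leq_addr.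
Qed.

Lemma ncross_inj (R : realFieldType) (T V : finType) (f : T -> V) (P : V -> R * R * R)
    (w : V -> V -> nat) : injective f ->
  (ncross (fun x => P (f x)) (fun x y => w (f x) (f y)) <= ncross P w)%N.
Proof.
move=> fI; rewrite /ncross.
apply: leq_trans (sum_inj_le _ fI); apply: leq_sum => x _.
apply: leq_trans (sum_inj_le _ fI); apply: leq_sum => y _.
apply: leq_trans (sum_inj_le _ fI); apply: leq_sum => z _.
exact: (sum_inj_le _ fI).
Qed.

Lemma generic_drawing (R : realType) (T : finType) (G : sgraph T) (P : T -> R * R * R)
    (w : T -> T -> nat) : generic P -> (forall x, w x x = 0%N) ->
  (forall x y, adj G x y -> (0 < w x y)%N) ->
  exists2 D : drawing R T, good_drawing G D & (8 * crossings G D <= ncross P w)%N.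
Proof.
move=> gP w0 wG; have [P' [sgP' gP']] := perturb P.
exists (arcs P'); first by split; [exact: arcs_is_drawing|exact: arcs_is_good].
apply: leq_trans (arcs_crossings gP' wG) _.
rewrite (ncross_perturb (P := P)) // => x y z wxy zx zy; apply: gP => //; rewrite 1?eq_sym //.
by apply: contraNneq wxy => ->; rewrite w0.
Qed.

Definition aq_word n (x : n.-tuple bool) : bits n := of_word n (fold_word (sums false x)).

Lemma aq_word_inj n : (2 < n)%N -> injective (@aq_word n).
Proof.
move=> n2 x y /(congr1 (@word n)); rewrite !of_wordK ?size_fold_word ?size_sums ?size_tuple //.
move=> /fold_word_inj; rewrite size_sums size_tuple => /(_ n2) /sums_inj e.
exact: val_inj.
Qed.

Lemma aq_drawing (R : realType) m : exists2 D : drawing R ((m.+4.+1 + 3).-tuple bool),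
  good_drawing (AQ (m.+4.+1 + 3)) D &
  crossing_bound (m.+4.+1 + 3) (8 * crossings (AQ (m.+4.+1 + 3)) D).
Proof.
have [P gP b] := last_drawing R m.
have fI : injective (@aq_word (m.+4.+1 + 3)) by apply: aq_word_inj; rewrite addn3.
have [x y z xy yz xz|x|x y xy|D gD cD] := @generic_drawing R _ (AQ (m.+4.+1 + 3))
    (fun x => P (aq_word x)) (fun x y => weight_last (m := m.+4) (aq_word x) (aq_word y)).
- by apply: gP; rewrite (eqtype.inj_eq fI).
- by rewrite /weight_last /ext_last !eqxx.
- by apply: fan_weight_last; rewrite ?size_sums ?size_tuple //; apply: aq_adj_fan.
exists D => //; move: b; rewrite /crossing_bound; apply: leq_trans; rewrite leq_add2r leq_mul2l /=.
exact: leq_trans cD (ncross_inj _ _ fI).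
Qed.

Theorem theorem1p1 (R : realType) (n : nat) (hn : (8 <= n)%N) :
  (crossing_number R (AQ n) <
     (26%:R / 32%:R * 4%:R ^+ n
      - (2%:R * n%:R ^+ 2 + 7%:R / 2%:R * n%:R - 6%:R) * 2%:R ^+ (n - 2))%:E)%E.
Proof.
have [m en] : exists m, n = (m.+4.+1 + 3)%N by exists (n - 8)%N; lia.
have [D gD b] := aq_drawing R m; rewrite -en in D gD b *.
apply: (@le_lt_trans _ _ (crossings (AQ n) D)%:R%:E).
  by apply: ereal_inf_lbound; exists D.
rewrite lte_fin; move: b; rewrite /crossing_bound -(ler_nat R) natrD !natrM !natrD !natrM !natrX.
(* Turns the [2 ^ (n + 2)] of [crossing_bound] into 16 times the power in the statement. *)
have -> : (n + 2 = n - 2 + 4)%N by lia.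
rewrite exprD; set d := 2%:R ^+ (n - 2); set q := 4%:R ^+ n; set c := (crossings _ _)%:R.
have d0 : 0 < d by rewrite exprn_gt0.
have n0 : (0 : R) <= n%:R by rewrite ler0n.
have nd : 0 <= n%:R * d by rewrite mulr_ge0 // ltW.
move: nd; move: (n%:R : R) => x nd h.
(* Strictness comes from [(4n + 6) - (7n/2 - 6) = n/2 + 12 > 0]. *)
have : d * (2 * x ^+ 2 + 4 * x + 6) + c <= 13 / 16 * q by move: h; lra.
lra.
Qed.
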